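(* For every integer $r \ge 2$ and every $\varepsilon > 0$ there exists $C = C(\varepsilon, r)$ such that for all integers $k \ge r$ and $\ell$, if $\operatorname{ind}_r(k,\ell) > \varepsilon$ then \[ \ell \in \Big\{ \sum_{d=0}^{r} \ell_d \binom{k-d}{r-d} \;:\; \ell_0 \in \{0,1\},\ \ell_1, \ldots, \ell_r \in \mathbb{Z} \cap [-C, C] \Big\}. \]
   Context: For an integer $r \ge 2$, integers $n \ge k \ge 1$ and $\ell$, let $N_r(n,k,\ell)$ be the maximum, over all $r$-uniform hypergraphs on $n$ vertices, of the number of $k$-element vertex subsets that induce exactly $\ell$ edges. The sequence $N_r(n,k,\ell)/\binom{n}{k}$ is non-increasing in $n$, and $\operatorname{ind}_r(k,\ell) = \lim_{n \to \infty} N_r(n,k,\ell)/\binom{n}{k}$. *)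

(* Defs.v *)
From mathcomp Require Import all_boot all_order all_algebra.
From mathcomp Require Import all_classical all_reals all_analysis.

Set Implicit Arguments.
Unset Strict Implicit.
Unset Printing Implicit Defensive.

Import Order.TTheory GRing.Theory Num.Theory.
Import numFieldNormedType.Exports.

Local Open Scope ring_scope.
Local Open Scope classical_set_scope.

(* A hypergraph on a vertex type T is given by its edge set. *)
Definition uniform_hypergraph (r : nat) (T : finType) (H : {set {set T}}) :
  bool := [forall e in H, #|e| == r].

Definition induced_edges (T : finType) (H : {set {set T}}) (S : {set T}) :
  {set {set T}} := [set e in H | e \subset S]%SET.

Definition num_inducing (T : finType) (H : {set {set T}}) (k : nat) (l : int) :
  nat :=
  #|[set S : {set T} | (#|S| == k) && (#|induced_edges H S|%:Z == l)]%SET|.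

Definition max_inducing (r n k : nat) (l : int) : nat :=
  (\max_(H : {set {set 'I_n}} | uniform_hypergraph r H) num_inducing H k l)%N.

(* The terms with n < k are 0 / 0 = 0 and do not affect the limit. *)
Definition inducibility (R : realType) (r k : nat) (l : int) : R :=
  lim ((fun n : nat => (max_inducing r n k l)%:R / ('C(n, k))%:R : R) @ \oo).

(* Main.v *)
(** Sample a random k-subset S of a 2k-set W on which the value l has density at
    least eps.  The number of edges in S is a polynomial of degree r, and a
    Littlewood-Offord argument for polynomials shows that it can take one value
    this often only if fixing the trace A of S on a bounded set of vertices
    makes it constant.  Off these vertices the edge count becomes a sum of
    weights w(T) over T included in S, where w(T) counts the edges with trace
    T.  The weights are bounded integers, lie in {0, 1} for #|T| = r, and for
    large k constancy of the sum forces w(T) to depend only on #|T|.  So l is a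
    bounded integer combination of the C(k - #|A|, j), which is rewritten in
    the basis C(k - d, r - d). *)

Require Import Defs.
From mathcomp Require Import all_boot all_order all_algebra ring lra zify.

Set Implicit Arguments.
Unset Strict Implicit.
Unset Printing Implicit Defensive.

Import Order.TTheory GRing.Theory Num.Theory.

Local Open Scope ring_scope.

(** * Averages over the cube *)

Section Mean.
Variables (R : archiRealFieldType) (I : finType).
Implicit Types (phi psi : {set I} -> R) (b y Y : {set I}) (P Q : pred {set I}).

(** Littlewood-Offord needs independent bits, and a uniform [k]-subset has none. They come from
    disjoint pairs of vertices: each pair that [S] meets in exactly one vertex can be reoriented
    freely without changing [#|S|]. This is why the degree on a slice is measured by exchange
    differences, and why the ground set is cut down to [2k] points: a prescribed family of [d] pairs
    is then split by [S] with probability at least [16 ^- d], whatever [k] is. Each round of fixing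
    a trace lowers the degree by one and there are at most [r] rounds, so the number of fixed
    vertices depends only on [eps] and [r]. The restriction of [l_0] to 0 and 1 survives the change
    of basis because that change is unitriangular: the coordinate at [d = 0] receives only the
    weight of the [r]-sets, with coefficient 1. The basis change moves only from smaller to larger
    offsets, so [r] further vertices are put into the trace beforehand. *)

Definition mean phi : R := (2 ^+ #|I|)^-1 * \sum_b phi b.

Definition prob P : R := mean (fun b => (P b)%:R).

Lemma expr2_gt0 n : 0 < 2 ^+ n :> R.
Proof. by apply: exprn_gt0. Qed.

Lemma eq_mean phi psi : phi =1 psi -> mean phi = mean psi.
Proof. by move=> e; congr (_ * _); apply: eq_bigr. Qed.

Lemma le_mean phi psi : (forall b, phi b <= psi b) -> mean phi <= mean psi.
Proof.
move=> h; apply: ler_wpM2l; first by rewrite invr_ge0 ltW ?expr2_gt0.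
exact: ler_sum.
Qed.

Lemma mean_cst (c : R) : mean (fun=> c) = c.
Proof.
have cardE : #|{: {set I}}| = (2 ^ #|I|)%N.
  by have := card_powerset [set: I]; rewrite powersetT !cardsT.
rewrite /mean sumr_const -[_ *+ #|_|]mulr_natl [X in X%:R * _]cardE natrX mulKf //.
by rewrite gt_eqF ?expr2_gt0.
Qed.

Lemma meanD phi psi : mean (fun b => phi b + psi b) = mean phi + mean psi.
Proof. by rewrite /mean big_split mulrDr. Qed.

Lemma meanZ (c : R) phi : mean (fun b => c * phi b) = c * mean phi.
Proof. by rewrite /mean -mulr_sumr mulrCA. Qed.

Lemma mean_sum (J : Type) (s : seq J) (F : J -> {set I} -> R) :
  mean (fun b => \sum_(j <- s) F j b) = \sum_(j <- s) mean (F j).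
Proof. by rewrite /mean exchange_big mulr_sumr. Qed.

Lemma mean_exchange (F : {set I} -> {set I} -> R) :
  mean (fun b => mean (F b)) = mean (fun y => mean (F^~ y)).
Proof.
rewrite /mean; congr (_ * _); rewrite -!mulr_sumr; congr (_ * _).
exact: exchange_big.
Qed.

Lemma mean_involution (h : {set I} -> {set I}) phi :
  involutive h -> mean (phi \o h) = mean phi.
Proof.
by move=> hK; rewrite /mean [in RHS](reindex_inj (inv_inj hK)).
Qed.

Lemma sqr_mean_le phi : mean phi ^+ 2 <= mean (fun b => phi b ^+ 2).
Proof.
set m := mean phi.
have: 0 <= mean (fun b => (phi b - m) ^+ 2).
  by rewrite -[0]mean_cst; apply: le_mean => b; rewrite sqr_ge0.
rewrite (@eq_mean _ (fun b => (phi b ^+ 2 + (- (2 * m)) * phi b) + m ^+ 2));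
  last by move=> b; ring.
rewrite !meanD mean_cst meanZ -/m; nra.
Qed.

Lemma prob_ge0 P : 0 <= prob P.
Proof. by rewrite -[0]mean_cst; apply: le_mean => b; rewrite ler0n. Qed.

Lemma prob_le1 P : prob P <= 1.
Proof. by rewrite -[1]mean_cst; apply: le_mean => b; case: (P b). Qed.

Lemma le_prob P Q : (forall b, P b -> Q b) -> prob P <= prob Q.
Proof.
move=> h; apply: le_mean => b; rewrite ler_nat.
by have := h b; case: (P b) => // ->.
Qed.

Lemma eq_prob P Q : P =1 Q -> prob P = prob Q.
Proof. by move=> e; apply: eq_mean => b; rewrite e. Qed.

Lemma probUn (n : nat) (P : nat -> pred {set I}) (d : R) :
  (forall i, (i < n)%N -> prob (P i) <= d) ->
  prob (fun b => [exists i : 'I_n, P i b]) <= n%:R * d.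
Proof.
move=> h.
apply: (@le_trans _ _ (\sum_(i < n) prob (P i))); last first.
  rewrite -[n in n%:R]card_ord mulr_natl -sumr_const.
  by apply: ler_sum => i _; apply: h.
rewrite -mean_sum; apply: le_mean => b; case: existsP => [[i Pi]|_].
  by rewrite (bigD1 i) //= Pi lerDl; apply: sumr_ge0 => k _; rewrite ler0n.
by apply: sumr_ge0 => k _; rewrite ler0n.
Qed.

Definition toggle (j : I) b := if j \in b then b :\ j else j |: b.

Lemma toggleK j : involutive (toggle j).
Proof.
move=> b; rewrite /toggle; have [jb|jb] := boolP (j \in b).
  by rewrite !inE eqxx /= setD1K.
by rewrite !inE eqxx /= setU1K.
Qed.

Lemma mean_split (j : I) phi :
  mean phi = (mean (fun b => phi (j |: b)) + mean (fun b => phi (b :\ j))) / 2.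
Proof.
have -> : mean phi = (mean phi + mean (phi \o toggle j)) / 2.
  rewrite (mean_involution _ (toggleK j)); by field.
congr (_ * _); rewrite -!meanD; apply: eq_mean => b /=; rewrite /toggle.
have [jb|jb] := boolP (j \in b).
  by congr (phi _ + phi _); apply/setP => i; rewrite !inE; case: eqP => // ->.
rewrite addrC; congr (phi _ + phi _); apply/setP => i; rewrite !inE.
by case: eqP => // ->; rewrite (negbTE jb).
Qed.

Definition mix Y b y := (b :\: Y) :|: (y :&: Y).

Lemma in_mix Y b y i : (i \in mix Y b y) = if i \in Y then i \in y else i \in b.
Proof. by rewrite !inE; case: (i \in Y); rewrite ?andbF ?andbT ?orbF. Qed.

(* [(b, y) |-> (mix Y b y, mix Y y b)] is an involution of pairs. *)
Lemma mean_mix Y phi :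
  mean (fun b => mean (fun y => phi (mix Y b y))) = mean phi.
Proof.
pose h (p : {set I} * {set I}) := (mix Y p.1 p.2, mix Y p.2 p.1).
have hK : involutive h.
  case=> b y; rewrite /h /=; congr pair; apply/setP => i;
  by rewrite !in_mix; case: (i \in Y).
transitivity (mean (fun b => mean (fun y : {set I} => phi b))); last first.
  by apply: eq_mean => b; rewrite mean_cst.
rewrite /mean; congr (_ * _); rewrite -!mulr_sumr; congr (_ * _).
rewrite !pair_big /= [RHS](reindex_inj (inv_inj hK)) /=.
by apply: eq_bigr => -[b y] _.
Qed.

End Mean.
Arguments prob R {I} P.

(** * Discrete derivatives *)

Section Derivative.
Variable I : finType.
Implicit Types (F G : {set I} -> int) (b y Y : {set I}) (i j : I).

(** The partial derivative, in coordinate [i], of the multilinear extension of [F]; its value at [b]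
    ignores whether [i] lies in [b]. *)
Definition deriv i F b : int := F (i |: b) - F (b :\ i).

(* [dlt n F]: as a multilinear polynomial on the cube, F has degree < n. *)
Fixpoint dlt (n : nat) F : Prop :=
  if n is m.+1 then forall i, dlt m (deriv i F) else forall b, F b = 0.

Definition derivs (e : seq I) F := foldl (fun G i => deriv i G) F e.

Lemma eq_deriv i F G : F =1 G -> deriv i F =1 deriv i G.
Proof. by move=> e b; rewrite /deriv !e. Qed.

Lemma eq_derivs e F G : F =1 G -> derivs e F =1 derivs e G.
Proof. by elim: e F G => //= i e IH F G h; apply/IH/eq_deriv. Qed.

Lemma eq_dlt n F G : F =1 G -> dlt n F -> dlt n G.
Proof.
elim: n F G => [|n IH] F G e /= h; first by move=> b; rewrite -e.
by move=> i; apply: IH (h i); apply: eq_deriv.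
Qed.

Lemma dlt0 n F : F =1 (fun=> 0) -> dlt n F.
Proof.
elim: n F => [|n IH] F e //= i; apply: IH => b; by rewrite /deriv !e subrr.
Qed.

Lemma dltB n F G : dlt n F -> dlt n G -> dlt n (fun b => F b - G b).
Proof.
elim: n F G => [|n IH] F G /= hF hG; first by move=> b; rewrite hF hG subrr.
move=> i; apply: eq_dlt (IH _ _ (hF i) (hG i)) => b; rewrite /deriv; ring.
Qed.

Lemma dlt_derivs n e F : dlt (n + size e) F -> dlt n (derivs e F).
Proof.
by elim: e F => [|i e IH] F /=; rewrite ?addn0 // addnS => h; apply: IH.
Qed.

Lemma derivC i j F : deriv i (deriv j F) =1 deriv j (deriv i F).
Proof.
move=> b; rewrite /deriv; have [->//|ij] := eqVneq i j.
have E (x y : I) : x != y -> (x |: b) :\ y = x |: (b :\ y).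
  move=> xy; apply/setP => z; rewrite !inE.
  by have [->|] := eqVneq z y; rewrite //= eq_sym (negbTE xy).
have -> : b :\ i :\ j = b :\ j :\ i.
  by apply/setP => z; rewrite !inE andbCA.
by rewrite (setUCA [set j]) (E i j) // (E j i) 1?eq_sym //; ring.
Qed.

Lemma derivs_deriv e i F : derivs e (deriv i F) =1 deriv i (derivs e F).
Proof.
elim: e F => //= j e IH F b; rewrite -IH; apply: eq_derivs => c.
exact: derivC.
Qed.

Lemma fix_coord F Y b y : (forall i c, i \in Y -> deriv i F c = 0) ->
  F (mix Y b y) = F b.
Proof.
move: {2}#|Y| (leqnn #|Y|) => n; elim: n Y => [|n IH] Y.
  rewrite leqn0 cards_eq0 => /eqP-> _; congr F; apply/setP => i.
  by rewrite in_mix inE.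
have [->|[i iY]] := set_0Vmem Y; first by move=> _; apply: IH; rewrite cards0.
rewrite (cardsD1 i) iY add1n ltnS => cY h.
rewrite -[RHS](IH (Y :\ i)) // => [|k c /setD1P[_]]; last exact: h.
have E c : F (i |: c) = F (c :\ i) by apply/subr0_eq/h.
have T c : F c = F (c :\ i).
  have [ic|ic] := boolP (i \in c); last first.
    by congr F; apply/setP => k; rewrite !inE; case: eqP => // ->; apply/negbTE.
  rewrite -{1}(setD1K ic) E; congr F; apply/setP => k.
  by rewrite !inE; case: eqP.
rewrite T [RHS]T; congr F; apply/setP => k.
by rewrite in_setD1 [in RHS]in_setD1 !in_mix in_setD1; case: eqP.
Qed.

Lemma dlt1_cst F : dlt 1 F -> forall b c, F b = F c.
Proof.
move=> h b c; rewrite -(@fix_coord F [set: I] b c) => [|i d _]; last exact: h.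
by congr F; apply/setP => i; rewrite in_mix inE.
Qed.

Lemma deriv_mix i Y b F :
  deriv i (fun y => F (mix Y b y)) =1
  (fun y => if i \in Y then deriv i F (mix Y b y) else 0).
Proof.
move=> y; rewrite /deriv; case: ifPn => iY.
  by congr (F _ - F _); apply/setP => k; rewrite !(in_mix, inE);
    case: (eqVneq k i) => [->|]; rewrite ?iY.
have -> : mix Y b (i |: y) = mix Y b (y :\ i); last by rewrite subrr.
by apply/setP => k; rewrite !(in_mix, inE); case: (eqVneq k i) => [->|];
  rewrite ?(negbTE iY).
Qed.

Lemma dlt_mix n Y b F : dlt n F -> dlt n (fun y => F (mix Y b y)).
Proof.
elim: n F => [|n IH] F /= h; first by move=> y.
move=> i; apply: eq_dlt (fsym (deriv_mix i Y b F)) _.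
by case: (i \in Y); [apply: IH | apply: dlt0].
Qed.

End Derivative.

(** * Littlewood-Offord bounds *)

Section Walk.
Variable R : archiRealFieldType.

(* The probability that a simple random walk started at c stays positive for
   s steps. *)
Fixpoint walk (s c : nat) : R :=
  match s, c with
  | 0, _ => (0 < c)%N%:R
  | _, 0 => 0
  | s'.+1, c'.+1 => (walk s' c'.+2 + walk s' c') / 2
  end.

Lemma walk0 s : walk s 0 = 0. Proof. by case: s. Qed.

Lemma walk_le1 s c : walk s c <= 1.
Proof.
elim: s c => [|s IH] [|c] //=; have := IH c.+2; have := IH c; lra.
Qed.

Lemma walk_concave s c : walk s c.+2 + walk s c <= 2 * walk s c.+1.
Proof.
elim: s c => [|s IH] [|c] /=; rewrite ?walk0; [lra|lra| |].
  by have := IH 1%N; have := IH 0%N; rewrite walk0; lra.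
by have := IH c.+2; have := IH c; lra.
Qed.

(** Concavity in the starting point: moving two starting points symmetrically apart only lowers the
    sum, so the nearest spread, one step of the walk, is the worst case. *)
Lemma walk_spread s c t : (0 < t)%N -> (t <= c)%N ->
  walk s (c + t) + walk s (c - t) <= walk s c.+1 + walk s c.-1.
Proof.
have slope d e : (d <= e)%N ->
    walk s e.+1 - walk s e <= walk s d.+1 - walk s d.
  elim: e => [|e IH]; first by rewrite leqn0 => /eqP->.
  rewrite leq_eqVlt => /predU1P[->//|]; rewrite ltnS => /IH.
  have := walk_concave s e; lra.
elim: t => // t IH _ tc; case: t IH tc => [|t] IH tc.
  by rewrite addn1 subn1.
apply: le_trans (IH isT (ltnW tc)).
have := @slope (c - t.+2)%N (c + t.+1)%N.
have -> : (c - t.+2).+1 = (c - t.+1)%N by lia.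
have -> : (c + t.+1).+1 = (c + t.+2)%N by lia.
by move=> h; have := h ltac:(lia); lra.
Qed.

(** The right-hand side is a supersolution of the recursion. The term [c / L] is harmonic and is
    already 1 at [c = L]. The weight [c * (2L - c)] drops by 1 when averaged over [c - 1] and
    [c + 1]; being at most [L ^ 2], this loss pays for replacing [s] by [s + 1] in the
    denominator. *)
Lemma walk_bound (L s c : nat) : (0 < L)%N -> (c <= L)%N ->
  walk s c <= c%:R / L%:R
    + c%:R * (2 * L%:R - c%:R) * (L%:R ^+ 2 / (L%:R ^+ 2 + s%:R)).
Proof.
move=> L0; have l0 : 1 <= L%:R :> R by rewrite ler1n.
have l2 : 1 <= L%:R ^+ 2 :> R by rewrite exprn_ege1.
have rhs0 (d k : nat) : (d <= L)%N -> 0 <= d%:R *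
    (2 * L%:R - d%:R) * (L%:R ^+ 2 / (L%:R ^+ 2 + k%:R)) :> R.
  move=> dL; have dR : d%:R <= L%:R :> R by rewrite ler_nat.
  have d0 : 0 <= d%:R :> R by [].
  have k0 : 0 <= k%:R :> R by [].
  by rewrite !mulr_ge0 ?invr_ge0 //; lra.
elim: s c => [|s IH] c cL.
  rewrite addr0 divff ?mulr1; last by lra.
  case: c cL => [|c] cL; first by rewrite /= !mul0r addr0.
  have cR : c.+1%:R <= L%:R :> R by rewrite ler_nat.
  have c1 : 1 <= c.+1%:R :> R by rewrite ler1n.
  have : 0 <= c.+1%:R / L%:R :> R by rewrite divr_ge0.
  by rewrite /=; nra.
move: cL; rewrite leq_eqVlt => /predU1P[->|cL].
  rewrite divff; last by lra.
  by have := walk_le1 s.+1 L; have := rhs0 L s.+1 (leqnn _); lra.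
case: c cL => [|c] cL; first by rewrite /= !mul0r addr0.
have := IH c.+2 cL; have := IH c ltac:(lia).
rewrite /=; set x := walk s _; set y := walk s _ => hx hy.
have cR : c%:R + 2 <= L%:R :> R by rewrite -natrD ler_nat; lia.
have c0 : 0 <= c%:R :> R by [].
have s0 : 0 <= s%:R :> R by [].
have c2E : c.+2%:R = c%:R + 2 :> R by rewrite -natrD addn2.
move: hx hy; rewrite c2E -![c.+1%:R]natr1 -[s.+1%:R]natr1.
set l := L%:R in l0 l2 cR *; set a := c%:R in cR c0 *; set t := s%:R in s0 *.
set B := _ / (_ + t); set B' := _ / (_ + (t + 1)) => hx hy.
have BE : B * (l ^+ 2 + t) = l ^+ 2 by rewrite divfK //; lra.
have BE' : B' * (l ^+ 2 + t + 1) = l ^+ 2 by rewrite -addrA divfK //; lra.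
have B0 : 0 <= B by rewrite divr_ge0 //; lra.
have key : ((a + 1) * (2 * l - (a + 1)) - 1) * B
    <= (a + 1) * (2 * l - (a + 1)) * B'.
  have W : (a + 1) * (2 * l - (a + 1)) <= l ^+ 2.
    have := sqr_ge0 (l - (a + 1)); rewrite !expr2; lra.
  set w := _ * (2 * l - _) in W *.
  have q0 : 0 < l ^+ 2 + t + 1 by lra.
  have BE1 : B * (l ^+ 2 + t + 1) = l ^+ 2 + B by rewrite mulrDr mulr1 BE.
  rewrite -(ler_pM2r q0) -mulrA BE1 -[leRHS]mulrA BE'.
  have : 0 <= (l ^+ 2 + t + 1 - w) * B by rewrite mulr_ge0 //; lra.
  move: BE1; lra.
have -> : (a + 1) / l = ((a + 2) / l + a / l) / 2.
  by field; lra.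
move: key hx hy; rewrite !mulrDl !mulrDr; nra.
Qed.

Lemma walk_small (d : R) : 0 < d -> exists s, walk s 1 <= d.
Proof.
move=> d0.
(* [L] makes the harmonic term of [walk_bound] at most [d / 2]; then [s], of order [L ^ 3 / d], does
   the same for the other term. *)
pose L := (Num.bound (2 / d)).+1.
have hL : 2 / d < L%:R.
  apply: lt_le_trans (archi_boundP _) _; first by rewrite divr_ge0 // ltW.
  by rewrite ler_nat.
pose s := Num.bound (4 * L%:R ^+ 3 / d).
have hs : 4 * L%:R ^+ 3 / d < s%:R.
  apply: archi_boundP; rewrite divr_ge0 ?mulr_ge0 ?exprn_ge0 //; exact: ltW.
exists s; apply: le_trans (@walk_bound L s 1 isT isT) _.
have l0 : 1 <= L%:R :> R by rewrite ler1n.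
have l2 : 1 <= L%:R ^+ 2 :> R by rewrite exprn_ege1.
rewrite mul1r; move: hL hs; rewrite !ltr_pdivrMr // => hL hs.
have h1 : L%:R^-1 <= d / 2.
  by rewrite ler_pdivlMr // mulrC ler_pdivrMr; lra.
have s0 : 0 <= s%:R :> R by [].
have h2 : (2 * L%:R - 1) * (L%:R ^+ 2 / (L%:R ^+ 2 + s%:R)) <= d / 2.
  rewrite mulrA ler_pdivrMr; last by lra.
  have : 0 <= d * L%:R ^+ 2 by rewrite mulr_ge0 //; lra.
  have : (2 * L%:R - 1) * L%:R ^+ 2 = 2 * L%:R ^+ 3 - L%:R ^+ 2 :> R by ring.
  lra.
by rewrite !mul1r; lra.
Qed.

End Walk.

Section LittlewoodOfford.
Variables (R : archiRealFieldType) (I : finType).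
Implicit Types (q : {set I} -> int) (b y Y A : {set I}).

Lemma affine_slope q j b : dlt 2 q -> deriv j q b = deriv j q set0.
Proof. by move=> h; apply: dlt1_cst (h j) _ _. Qed.

(** [U] and [N] are the union and the intersection of [V] and [V - a]. For nonempty [V] the
    intersection is strictly smaller than [V], since [V - a = V] would change the sum of the
    elements by [a] times their number. *)
Lemma translate_split (V : seq int) (a : int) : uniq V -> a != 0 ->
  exists U N : seq int,
  [/\ uniq U, uniq N, (size N <= (size V).-1)%N,
      (size U + size N = size V + size V)%N &
      forall x : int,
        ((x \in V) + (x + a \in V)%R = (x \in U) + (x \in N))%N].
Proof.
move=> uV a0; pose V' := [seq v - a | v <- V].
have inV' x : (x \in V') = (x + a \in V).
  apply/mapP/idP => [[v vV ->]|xV]; first by rewrite subrK.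
  by exists (x + a) => //; rewrite addrK.
have uV' : uniq V' by rewrite map_inj_uniq //; apply: addIr.
have sV' : size V' = size V by rewrite size_map.
exists (V ++ [seq v <- V' | v \notin V]), [seq v <- V' | v \in V]; split.
- rewrite cat_uniq uV filter_uniq // andbT; apply/hasPn => v.
  by rewrite mem_filter => /andP[].
- exact: filter_uniq.
- case: (posnP (size V)) => [V0|V0].
    by rewrite size_filter (leq_trans (count_size _ _)) // sV' V0.
  rewrite -ltnS prednK // -sV' size_filter ltn_neqAle count_size andbT.
  rewrite -all_count; apply/negP => /allP sub.
  have [_ e] := uniq_min_size uV' sub (eq_leq (esym sV')).
  have pV : perm_eq V' V by apply: uniq_perm.
  have := perm_big _ pV : \sum_(v <- V') v = \sum_(v <- V) v.
  rewrite big_map big_split /= big_const_seq count_predT iter_addr_0 => /eqP.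
  rewrite -subr_eq0 [X in X - _]addrC addrK mulNrn oppr_eq0 mulrn_eq0.
  by rewrite (negbTE a0) eqn0Ngt V0.
- by rewrite size_cat -addnA !size_filter -sV' addnC
    [(count _ _ + _)%N]addnC count_predC sV'.
- move=> x; rewrite mem_cat !mem_filter inV'.
  by case: (x \in V); case: (x + a \in V).
Qed.

(** Conditioning on one bit with slope [a] turns the target set [V] into [V] and [V - a], which
    count together like their union and intersection. These have sizes [c + t] and [c - t] with
    [t > 0], where [c] is the size of [V], and [walk_spread] reduces to [t = 1]: the size of the
    target set performs a simple random walk absorbed at 0. *)
Lemma littlewood_offord s q A : dlt 2 q -> #|A| = s ->
  (forall j, j \in A -> deriv j q set0 != 0) ->
  forall V : seq int, uniq V -> prob R (fun b => q b \in V) <= walk R s (size V).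
Proof.
elim: s q A => [|s IH] q A hq cA hA V uV.
  case: V uV => [|v V] uV /=; last exact: prob_le1.
  by rewrite [leLHS](mean_cst I (0 : R)).
have [j jA] : exists j, j \in A by apply/set0Pn; rewrite -card_gt0 cA.
pose a := deriv j q set0.
pose q' b := q (b :\ j).
have q'E : q' =1 (fun y => q (mix (~: [set j]) set0 y)).
  move=> y; congr q; apply/setP => k; rewrite in_mix !inE.
  by case: eqP.
have hq' : dlt 2 q' by apply: eq_dlt (fsym q'E) _; apply: dlt_mix.
have cA' : #|A :\ j| = s by move: cA; rewrite (cardsD1 j) jA => -[].
have hA' k : k \in A :\ j -> deriv k q' set0 != 0.
  move=> /setD1P[kj kA]; rewrite (eq_deriv _ q'E) deriv_mix !inE kj.
  by rewrite affine_slope // hA.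
have qU b : q (j |: b) = q' b + a.
  by rewrite /a -(affine_slope j b hq) /deriv /q' addrC subrK.
have [U [N [uU uN sN sUN memUN]]] := translate_split uV (hA j jA).
case: V uV sN sUN memUN => [|v V] uV sN sUN memUN.
  by rewrite walk0 [leLHS](mean_cst I (0 : R)).
have -> : prob R (fun b => q b \in v :: V) =
    (prob R (fun b => q' b \in U) + prob R (fun b => q' b \in N)) / 2.
  rewrite {1}/prob (mean_split j); congr (_ * _); rewrite -!meanD.
  apply: eq_mean => b; rewrite qU addrC -!natrD; congr (_%:R).
  exact: memUN.
have hU := IH _ _ hq' cA' hA' _ uU; have hN := IH _ _ hq' cA' hA' _ uN.
have /= key := @walk_spread R s (size V).+1 ((size V).+1 - size N)
  ltac:(move: sN => /=; lia) ltac:(lia).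
move: key; have -> : ((size V).+1 + ((size V).+1 - size N) = size U)%N.
  by move: sUN sN => /=; lia.
have -> : ((size V).+1 - ((size V).+1 - size N) = size N)%N.
  by move: sN => /=; lia.
by move=> key; rewrite /=; lra.
Qed.

Lemma prob_affine_zero s q : dlt 2 q ->
  (s <= #|[set j | deriv j q set0 != 0]|)%N ->
  prob R (fun b => q b == 0) <= walk R s 1.
Proof.
move=> hq /card_geqP[e [ue se sub]].
have cA : #|[set j in e]| = s by rewrite cardsE (card_uniqP ue).
have hA j : j \in [set j in e] -> deriv j q set0 != 0.
  by rewrite inE => /sub; rewrite inE.
have := littlewood_offord hq cA hA (isT : uniq [:: 0]).
by congr (_ <= _); apply: eq_prob => b; rewrite inE.
Qed.

(* Each kept form [q i] does not involve the variables [u j] of the forms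
   selected after it, so the system is triangular. *)
Lemma prob_sparse_system (s t : nat) (u : nat -> I) (q : nat -> {set I} -> int)
    (L : seq nat) : (0 < s)%N -> uniq (map u L) -> (t * s <= size L)%N ->
  (forall i, i \in L -> [/\ dlt 2 (q i), deriv (u i) (q i) set0 != 0 &
     (#|[set j | deriv j (q i) set0 != 0]| <= s)%N]) ->
  prob R (fun b => all (fun i => q i b == 0) L) <= (2 ^+ t)^-1.
Proof.
move=> s0; elim: t q L => [|t IH] q L uL sL hL.
  by rewrite invr1; apply: prob_le1.
have [i iL] : exists i, i \in L.
  case: (L) sL => [|i L'] sL; last by exists i; rewrite mem_head.
  by move: sL; rewrite mulSn /= leqNgt addn_gt0 s0.
have [qi_aff qi_u qi_supp] := hL i iL.
set S := [set j | _] in qi_supp.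
(* The variables [u k] are distinct and [q i] involves at most [s] of them, so at most [s] indices
   are lost, [i] itself among them. *)
pose K := [seq k <- L | u k \notin S].
have KL : {subset K <= L} by move=> k; rewrite mem_filter => /andP[].
have uK : uniq (map u K) by apply: subseq_uniq uL; apply/map_subseq/filter_subseq.
have sK : (t * s <= size K)%N.
  have : (count (fun k => u k \in S) L <= s)%N.
    apply: leq_trans qi_supp; rewrite -size_filter -(size_map u) cardE.
    apply: uniq_leq_size => [|v /mapP[k]].
      by apply: subseq_uniq uL; apply/map_subseq/filter_subseq.
    by rewrite mem_filter mem_enum => /andP[kS _] ->.
  have := count_predC (fun k => u k \in S) L.
  have -> : size K = count (predC (fun k => u k \in S)) L by rewrite size_filter.
  by move: sL; rewrite mulSn; lia.
pose Y := [set j in map u K].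
have qi_fix b y : q i (mix Y b y) = q i b.
  apply: fix_coord => j c; rewrite inE => /mapP[k]; rewrite mem_filter => /andP[].
  by rewrite inE negbK => /eqP h _ ->; rewrite affine_slope.
pose Q b := all (fun k => q k b == 0) K.
apply: (@le_trans _ _ (prob R (fun b => (q i b == 0) && Q b))).
  by apply: le_prob => b /allP h; rewrite h //=; apply/allP => k /KL /h.
rewrite /prob -(mean_mix Y).
apply: (@le_trans _ _ (mean (fun b => (2 ^+ t)^-1 * (q i b == 0)%:R))).
  apply: le_mean => b.
  rewrite (@eq_mean _ _ _ (fun y => (q i b == 0)%:R * (Q (mix Y b y))%:R)).
    rewrite meanZ mulrC ler_wpM2r //.
    apply: (IH (fun k y => q k (mix Y b y)) K uK sK) => k kK.
    have [k1 k2 k3] := hL k (KL k kK); split.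
    - exact: dlt_mix.
    - rewrite deriv_mix; have -> : u k \in Y by rewrite inE map_f.
      by rewrite affine_slope.
    - apply: leq_trans k3; apply/subset_leq_card/fintype.subsetP => j.
      rewrite !inE deriv_mix; case: ifP => _; last by rewrite eqxx.
      by rewrite affine_slope.
  by move=> y; rewrite qi_fix -natrM mulnb.
rewrite meanZ exprS invfM mulrC; apply: ler_wpM2r.
  by rewrite invr_ge0 ltW ?expr2_gt0.
(* A single nonzero slope gives the bound [walk 1 1], which is [1 / 2]. *)
have : (1 <= #|S|)%N by apply/card_gt0P; exists (u i); rewrite inE.
move=> /(prob_affine_zero qi_aff) h; apply: (le_trans h).
by rewrite /=; lra.
Qed.

End LittlewoodOfford.

(** A form with more than [s] nonzero slopes already vanishes rarely by itself. If all forms are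
    sparse, a triangular subsystem of [t] forms can be extracted, and each of its members halves the
    probability. *)
Lemma prob_affine_system (R : archiRealFieldType) (d : R) : 0 < d ->
  exists m, forall (I : finType) (u : nat -> I) (q : nat -> {set I} -> int),
    {in gtn m &, injective u} ->
    (forall i, (i < m)%N -> dlt 2 (q i) /\ deriv (u i) (q i) set0 != 0) ->
    prob R (fun b => all (fun i => q i b == 0) (iota 0 m)) <= d.
Proof.
move=> d0; have [s hs] := walk_small d0.
pose t := Num.bound d^-1.
have ht : (2 ^+ t)^-1 <= d.
  rewrite invf_ple ?posrE ?expr2_gt0 //; apply: ltW.
  apply: lt_le_trans (archi_boundP _) _; first by rewrite invr_ge0 ltW.
  by rewrite -natrX ler_nat ltnW // ltn_expl.
exists (t * s.+1)%N => I u q uinj hq.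
have [/existsP[i hi]|] :=
    boolP [exists i : 'I_(t * s.+1), (s < #|[set j | deriv j (q i) set0 != 0]|)%N].
  have [qa _] := hq i (ltn_ord i).
  apply: le_trans hs; apply: le_trans (prob_affine_zero R qa (ltnW hi)).
  by apply: le_prob => b /allP h; apply: h; rewrite mem_iota ltn_ord.
rewrite negb_exists => /forallP small; apply: le_trans ht.
apply: (@prob_sparse_system _ _ s.+1 t u) => //.
- rewrite map_inj_in_uniq ?iota_uniq // => i j; rewrite !mem_iota /= !add0n => im jm.
  exact: (uinj _ _ im jm).
- by rewrite size_iota.
- move=> i; rewrite mem_iota /= add0n => im; have [q1 q2] := hq i im.
  by split=> //; have := small (Ordinal im); rewrite -leqNgt => /leq_trans; apply.
Qed.

(** * Anticoncentration of polynomials *)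

Section Increment.
Variable I : finType.
Implicit Types (F : {set I} -> int) (b y Y : {set I}).

Lemma mixC Y b y : mix Y b y = mix (~: Y) y b.
Proof. by apply/setP => k; rewrite !in_mix inE; case: (k \in Y). Qed.

Definition increment Y y y' F b : int := F (mix Y b y) - F (mix Y b y').

Lemma deriv_increment i Y y y' F : deriv i (increment Y y y' F) =1
  (fun b => if i \in Y then 0 else increment Y y y' (deriv i F) b).
Proof.
move=> b; transitivity (deriv i (fun b => F (mix (~: Y) y b)) b
    - deriv i (fun b => F (mix (~: Y) y' b)) b).
  rewrite /deriv /increment !(mixC Y); ring.
rewrite !deriv_mix inE /increment !(mixC Y).
by case: (i \in Y); rewrite ?subrr.
Qed.

Lemma dlt_increment n Y y y' F : dlt n.+1 F -> dlt n (increment Y y y' F).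
Proof.
elim: n F => [|n IH] F h.
  by move=> b; rewrite /increment (dlt1_cst h (mix Y b y) (mix Y b y')) subrr.
move=> i; apply: eq_dlt (fsym (deriv_increment i Y y y' F)) _.
by case: (i \in Y); [apply: dlt0 | apply: IH].
Qed.

Lemma derivs_increment e Y y y' F : {in e, forall i, i \notin Y} ->
  derivs e (increment Y y y' F) =1 increment Y y y' (derivs e F).
Proof.
elim: e F => [|i e IH] F h b //=.
rewrite -IH; last by move=> k ke; rewrite h // inE ke orbT.
apply: eq_derivs => c; rewrite deriv_increment.
by rewrite (negbTE (h i (mem_head _ _))).
Qed.

Lemma dlt_cst n (c : int) : dlt n.+1 (fun=> c : int) (I := I).
Proof. by move=> i; apply: dlt0 => b; rewrite /deriv subrr. Qed.

End Increment.

(* A polynomial of degree d with M disjoint nonzero top-degree monomials: the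
   decoupling step singles out one variable per monomial, forming the block Y;
   resampling Y and subtracting lowers the degree, and by
   [prob_affine_system] enough of the leading monomials survive. *)
Theorem poly_anticoncentration (R : archiRealFieldType) (d : nat) (delta : R) :
  0 < delta ->
  exists M, forall (I : finType) (F : {set I} -> int) (e : nat -> seq I),
    dlt d.+1 F ->
    (forall i, (i < M)%N ->
       [/\ size (e i) = d, uniq (e i) & derivs (e i) F set0 != 0]) ->
    (forall i j, (i < M)%N -> (j < M)%N -> i != j -> ~~ has (mem (e i)) (e j)) ->
    prob R (fun b => F b == 0) <= delta.
Proof.
elim: d delta => [|d IH] delta delta0.
  exists 1%N => I F e dF /(_ 0%N isT)[]; case: (e 0%N) => //= _ _ F0 _.
  apply: le_trans (ltW delta0); rewrite -[leRHS](@mean_cst R I).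
  by apply: le_mean => b; rewrite (dlt1_cst dF b set0) (negbTE F0).
(* Decoupling bounds the square of the probability; its budget [delta ^+ 2] is shared equally
   between bad resamplings and the induction hypothesis. *)
pose eta := delta ^+ 2 / 2.
have eta0 : 0 < eta by rewrite divr_gt0 ?exprn_gt0.
have [M1 hM1] := IH eta eta0.
have [m1 hm1] := prob_affine_system (divr_gt0 eta0 (ltr0Sn R M1)).
(* The monomials form [M'] groups of [m]. By the choice of [m1] a given group is bad with
   probability at most [eta / M'], and one surviving monomial per group suffices for the induction
   hypothesis. The successors keep [M' * m] positive, which supplies a variable [x0]. *)
pose M' := M1.+1; pose m := m1.+1.
exists (M' * m)%N => I F e dF he disj.
have idx (g c : nat) : (g < M')%N -> (c < m)%N -> (g * m + c < M' * m)%N.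
  move=> gM cm; apply: (@leq_trans (g * m + m)%N); first by rewrite ltn_add2l.
  by rewrite addnC -mulSn leq_mul2r gM orbT.
have x0 : I by have [] := he 0%N isT; case: (e 0%N).
pose u i := head x0 (e i); pose e' i := behead (e i).
have eE i : (i < M' * m)%N -> e i = u i :: e' i.
  by move=> /he[]; rewrite /u /e'; case: (e i).
have uin i : (i < M' * m)%N -> u i \in e i by move=> /eE->; rewrite mem_head.
have sep i j k : (i < M' * m)%N -> (j < M' * m)%N -> k \in e i -> k \in e j ->
    i = j.
  move=> iM jM ki kj; apply/eqP/negPn/negP => ij.
  by have /hasP[] := disj i j iM jM ij; exists k.
have uinj i j : (i < M' * m)%N -> (j < M' * m)%N -> u i = u j -> i = j.
  by move=> iM jM ij; apply: (sep i j (u i)); rewrite ?uin // ij uin.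
pose Y := [set k in map u (iota 0 (M' * m))].
have uY i : (i < M' * m)%N -> u i \in Y.
  by move=> iM; rewrite inE map_f // mem_iota.
have e'Y i : (i < M' * m)%N -> {in e' i, forall k, k \notin Y}.
  move=> iM k ke; rewrite inE; apply/mapP => -[j]; rewrite mem_iota /= => jM kE.
  have kei : k \in e i by rewrite eE // inE ke orbT.
  have ij := sep i j k iM jM kei; move: ij; rewrite kE uin // => /(_ isT) ij.
  by have [_] := he i iM; rewrite eE //= ij -kE -ij ke.
pose h i := derivs (e' i) F.
have h2 i : (i < M' * m)%N -> dlt 2 (h i).
  move=> iM; apply: dlt_derivs; have [] := he i iM.
  by rewrite eE //= => -[->].
have hu i : (i < M' * m)%N -> deriv (u i) (h i) set0 != 0.
  by move=> iM; have [_ _] := he i iM; rewrite eE //= derivs_deriv.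
(* After resampling, the coefficient of the shortened monomial [e' i] in the increment is the value
   of [h i] at [y] minus that at [y']: an affine form in [y] with nonzero slope at [u i]. A bad
   group is one where all the tested coefficients vanish. *)
pose bad (y' : {set I}) (g : nat) (y : {set I}) :=
  all (fun c => h (g * m + c)%N (mix Y set0 y) - h (g * m + c)%N (mix Y set0 y') == 0)
    (iota 0 m1).
have bad_prob y' g : (g < M')%N -> prob R (bad y' g) <= eta / M'%:R.
  move=> gM; apply: (hm1 _ (fun c => u (g * m + c)%N)
    (fun c y => h (g * m + c)%N (mix Y set0 y) - h (g * m + c)%N (mix Y set0 y'))).
    move=> c c'; rewrite !unfold_in => cm cm' /uinj E; apply: (@addnI (g * m)%N).
    by apply: E; apply: idx => //; apply: ltnW.
  move=> c cm; have iM := idx g c gM (ltnW cm); split.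
    by apply: dltB; [apply/dlt_mix/h2 | apply: dlt_cst].
  rewrite /deriv opprB addrA subrK -/(deriv _ (fun y => h _ (mix Y set0 y)) _).
  by rewrite deriv_mix uY // affine_slope ?hu //; apply: h2.
have good_prob y y' : ~~ [exists g : 'I_M', bad y' g y] ->
    prob R (fun b => increment Y y y' F b == 0) <= eta.
  rewrite negb_exists => /forallP good.
  have /fin_all_exists[c hc] (g : 'I_M') : exists c : 'I_m1,
      h (g * m + c)%N (mix Y set0 y) - h (g * m + c)%N (mix Y set0 y') != 0.
    have := good g; rewrite -has_predC => /hasP[c].
    by rewrite mem_iota /= add0n => cm hc; exists (Ordinal cm).
  pose sel g := if insub g is Some o then (g * m + c o)%N else 0%N.
  have selP (g : nat) (gM : (g < M')%N) : sel g = (g * m + c (Ordinal gM))%N.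
    by rewrite /sel insubT.
  have selM (g : nat) : (g < M')%N -> (sel g < M' * m)%N.
    by move=> gM; rewrite selP; apply: idx => //; apply/leqW/ltn_ord.
  apply: (hM1 _ _ (fun g => e' (sel g))); first exact: dlt_increment.
    move=> g gM1; have gM : (g < M')%N by apply: ltnW.
    have [se ue _] := he _ (selM g gM); move: se ue; rewrite eE ?selM //=.
    move=> -[se] /andP[_ ue]; split=> //.
    by rewrite derivs_increment ?(selP _ gM) //; [exact: hc|apply: e'Y; rewrite -selP selM].
  move=> g g' gM gM' gg'; apply: contra gg' => /hasP[k kg' kg].
  have {}kg : k \in e' (sel g) by [].
  have gl : (g < M')%N by apply: ltnW.
  have gl' : (g' < M')%N by apply: ltnW.
  have := sep (sel g) (sel g') k (selM _ gl) (selM _ gl').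
  rewrite !eE ?selM // !inE kg kg' !orbT => /(_ isT isT).
  rewrite !selP => /(congr1 (divn^~ m)).
  by rewrite !divnMDl // !divn_small ?addn0 ?ltnS ?(ltnW (ltn_ord _)) // => ->.
(* Decoupling: by Cauchy-Schwarz the square is at most the probability that [F] vanishes for two
   independent choices of the block [Y] with the rest shared, and then the increment vanishes
   too. *)
have key : prob R (fun b => F b == 0) ^+ 2 <= delta ^+ 2.
  rewrite /prob -(mean_mix Y).
  apply: le_trans (sqr_mean_le _) _.
  pose z b y : R := (F (mix Y b y) == 0)%:R.
  apply: (@le_trans _ _ (mean (fun b => mean (fun y' => mean (fun y =>
      (increment Y y y' F b == 0)%:R))))).
    apply: le_mean => b; rewrite expr2 -/(z b) -meanZ.
    apply: le_mean => y'; rewrite mulrC -meanZ; apply: le_mean => y.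
    rewrite /z -natrM mulnb ler_nat /increment.
    by case: eqP => // ->; case: eqP => // ->; rewrite subrr.
  rewrite mean_exchange (@eq_mean _ _ _ (fun y' => mean (fun y =>
    prob R (fun b => increment Y y y' F b == 0)))); last first.
    by move=> y'; rewrite mean_exchange.
  have -> : delta ^+ 2 = eta + eta by rewrite /eta; field.
  rewrite -[leRHS](@mean_cst R I); apply: le_mean => y'.
  apply: (@le_trans _ _ (mean (fun y => eta + [exists g : 'I_M', bad y' g y]%:R))).
    apply: le_mean => y; have [_|/good_prob] := boolP [exists g : 'I_M', bad y' g y].
      by apply: le_trans (prob_le1 _ _) _; rewrite lerDr ltW.
    by rewrite addr0.
  rewrite meanD mean_cst lerD2l.
  have := probUn (bad_prob y').
  by rewrite mulrCA divff ?mulr1 // pnatr_eq0.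
by rewrite -(@ler_pXn2r _ 2) // ?nnegrE ?prob_ge0 // ltW.
Qed.

(** * Slices *)

Section Slice.
Variable V : finType.
Implicit Types (W J A S : {set V}) (p : seq (V * V)).

Definition slice W (k : nat) := [set S : {set V} | S \subset W & #|S| == k].

Lemma card_slice W k : #|slice W k| = 'C(#|W|, k).
Proof. exact: cards_draws. Qed.

Lemma card_slice_fiber W J k (P : pred {set V}) A : J \subset W ->
  A \subset J -> (#|A| <= k)%N ->
  #|[set S in slice W k | P S & S :&: J == A]| =
  #|[set S in slice (W :\: J) (k - #|A|)%N | P (A :|: S)]|.
Proof.
move=> JW AJ Ak; rewrite -[RHS](card_in_imset (f := fun S => A :|: S)); last first.
  move=> S T; rewrite !inE !subsetD -!andbA => /and3P[_ dS _] /and3P[_ dT _] e.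
  have D (U : {set V}) : [disjoint U & J] -> (A :|: U) :\: J = U.
    move=> dU; rewrite setDUl (setDidPl dU).
    by move: AJ; rewrite -setD_eq0 => /eqP->; rewrite set0U.
  by rewrite -(D S) // e D.
apply: eq_card => S; rewrite !inE; apply/idP/imsetP.
  case/and3P=> /andP[SW /eqP cS] PS /eqP SJ; exists (S :\: J); last first.
    by rewrite -SJ setID.
  rewrite !inE setSD //= -{2}SJ setID PS andbT.
  by rewrite cardsD SJ cS.
case=> T; rewrite !inE subsetD => /andP[/andP[/andP[TW dT] /eqP cT] PT] ->.
have dAT : [disjoint A & T] by rewrite disjoint_sym (disjointWr AJ).
rewrite PT subUset TW (subset_trans AJ JW) cardsU cT (disjoint_setI0 dAT) cards0.
rewrite subn0 subnKC // eqxx /= setIUl (setIidPl AJ) (disjoint_setI0 dT).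
by rewrite setU0.
Qed.

Lemma slice_decomp W J k (P : pred {set V}) : J \subset W -> (#|J| <= k)%N ->
  #|[set S in slice W k | P S]| =
  (\sum_(A in powerset J) #|[set S in slice (W :\: J) (k - #|A|)%N | P (A :|: S)]|)%N.
Proof.
move=> JW Jk; rewrite -sum1_card.
rewrite (partition_big (fun S => S :&: J) (mem (powerset J))) /=; last first.
  by move=> S _; rewrite inE subsetIr.
apply: eq_bigr => A; rewrite inE => AJ.
rewrite -card_slice_fiber ?(leq_trans (subset_leq_card AJ)) //.
by rewrite -sum1_card; apply: eq_bigl => S; rewrite !inE andbA.
Qed.

(** Each of the [d] steps deletes one chosen and one unchosen point, at a cost of 4 each, because
    [k] and [N - k] are at least a quarter of [N]; the slack [8 * d] preserves this through all
    steps. *)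
Lemma leq_bin_remove (d N k : nat) : (N + 8 * d <= 4 * k)%N ->
  (4 * k + 8 * d <= 3 * N)%N ->
  ('C(N, k) <= 16 ^ d * 'C(N - 2 * d, k - d))%N.
Proof.
elim: d N k => [|d IH] N k h1 h2; first by rewrite muln0 !subn0 expn0 mul1n.
case: k h1 h2 => [|k] h1 h2; first by lia.
case: N h1 h2 => [|[|N]] h1 h2; [lia|lia|].
have e1 := mul_bin_diag N.+2 k; have e2 := mul_bin_down N.+1 k.
rewrite /= in e1 e2.
have b1 : ('C(N.+2, k.+1) <= 4 * 'C(N.+1, k))%N.
  rewrite -(leq_pmul2l (ltn0Sn k)) -e1 mulnCA mulnA leq_mul2r; lia.
have b2 : ('C(N.+1, k) <= 4 * 'C(N, k))%N.
  have p0 : (0 < N.+1 - k)%N by lia.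
  rewrite -(leq_pmul2l p0) -e2 mulnCA mulnA leq_mul2r; lia.
have b3 := IH N k ltac:(lia) ltac:(lia).
rewrite expnS -mulnA; have -> : (N.+2 - 2 * d.+1 = N - 2 * d)%N by lia.
rewrite subSS; lia.
Qed.

Definition verts p := map fst p ++ map snd p.

Definition splits p S := all (fun q => (q.1 \in S) (+) (q.2 \in S)) p.

Lemma verts_fst p q : q \in p -> q.1 \in verts p.
Proof. by move=> qp; rewrite mem_cat map_f. Qed.

Lemma verts_snd p q : q \in p -> q.2 \in verts p.
Proof. by move=> qp; rewrite mem_cat map_f ?orbT. Qed.

Lemma size_verts p : size (verts p) = (2 * size p)%N.
Proof. by rewrite size_cat !size_map addnn mul2n. Qed.

Lemma eq_splits p S (T : {set V}) : {in verts p, S =i T} -> splits p S = splits p T.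
Proof.
move=> e; apply: eq_in_all => q qp.
by rewrite !e ?verts_fst ?verts_snd.
Qed.

Variable R : archiRealFieldType.

(* Given the trace of S on the other boxes, S contains the first and omits the
   second vertex of every pair of p with probability at least 16 ^- d. *)
Lemma card_unsplit (d : nat) (L : seq (seq (V * V))) W k :
  uniq (flatten (map verts L)) -> all (fun p => size p == d) L ->
  {subset flatten (map verts L) <= W} ->
  (#|W| + 8 * d * size L <= 4 * k)%N -> (4 * k + 8 * d * size L <= 3 * #|W|)%N ->
  #|[set S in slice W k | all (fun p => ~~ splits p S) L]|%:R <=
  (1 - (16 ^+ d)^-1) ^+ size L * ('C(#|W|, k))%:R :> R.
Proof.
elim: L W k => [|p L IH] W k /=.
  move=> *; rewrite mul1r ler_nat -card_slice; apply/subset_leq_card.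
  by apply/fintype.subsetP => S; rewrite inE => /andP[].
rewrite cat_uniq => /and3P[up dpL uL] /andP[/eqP sp sL] LW h1 h2.
pose J := [set v in verts p].
have cJ : #|J| = (2 * d)%N by rewrite cardsE (card_uniqP up) size_verts sp.
have JW : J \subset W.
  by apply/fintype.subsetP => v; rewrite inE => vp; rewrite LW // mem_cat vp.
have Jk : (#|J| <= k)%N by rewrite cJ; lia.
have cWJ : #|W :\: J| = (#|W| - 2 * d)%N by rewrite cardsDS // cJ.
pose X := [set v in map fst p].
have XJ : X \subset J.
  by apply/fintype.subsetP => v; rewrite !inE mem_cat => ->.
have cX : #|X| = d.
  rewrite cardsE -sp -(size_map fst); apply/card_uniqP.
  by move: up; rewrite cat_uniq => /andP[].
set c := 1 - _; have c0 : 0 <= c.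
  by rewrite subr_ge0 invf_le1 ?exprn_gt0 // exprn_ege1 // ler1n.
have notJ q v : q \in L -> v \in verts q -> v \notin J.
  move=> qL vq; rewrite inE; apply: contra dpL => vp.
  by apply/hasP; exists v => //; apply/flattenP; exists (verts q); rewrite ?map_f.
have step A : A \subset J ->
   #|[set S in slice (W :\: J) (k - #|A|)%N | all (fun q => ~~ splits q (A :|: S)) (p :: L)]|%:R
     <= if A == X then 0 else c ^+ size L * ('C(#|W| - 2 * d, k - #|A|)%N)%:R :> R.
  move=> AJ; case: eqP => [->|_].
    rewrite lern0 cards_eq0; apply/eqP/setP => S; rewrite !inE /=.
    apply/negP => /andP[/andP[+ _] /andP[/negP h _]]; rewrite subsetD.
    move=> /andP[SW dS]; apply: h; apply/allP => q qp.
    have x1 : q.1 \in X by rewrite inE map_f.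
    have y1 : q.2 \notin X.
      move: up; rewrite cat_uniq inE => /and3P[_ /hasPn h _].
      by apply: h; rewrite map_f.
    have y2 : q.2 \notin S.
      by rewrite (disjointFl dS) // inE verts_snd.
    by rewrite !inE in x1 y1 *; rewrite x1 (negbTE y1) (negbTE y2).
  have cAJ := subset_leq_card AJ; rewrite cJ in cAJ.
  rewrite -cWJ; apply: le_trans (IH (W :\: J) (k - #|A|)%N _ _ _ _ _) => //.
  - rewrite ler_nat; apply/subset_leq_card/fintype.subsetP => S.
    rewrite !inE /= => /andP[-> /andP[_ h]] /=; apply/allP => q qL.
    move/allP: h => /(_ q qL); congr (~~ _); apply: eq_splits => v vq.
    rewrite inE; case: (boolP (v \in A)) => // vA.
    by have := notJ q v qL vq; rewrite (fintype.subsetP AJ).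
  - move=> v /flattenP[_ /mapP[q qL ->] vq]; rewrite inE (notJ q) //=.
    rewrite LW // mem_cat; apply/orP; right; apply/flattenP.
    by exists (verts q); rewrite ?map_f.
  - rewrite cWJ; lia.
  - rewrite cWJ; lia.
rewrite (slice_decomp _ JW Jk) natr_sum.
apply: (@le_trans _ _ (\sum_(A in powerset J)
    if A == X then 0 else c ^+ size L * ('C(#|W| - 2 * d, k - #|A|)%N)%:R)).
  by apply: ler_sum => A; rewrite inE; apply: step.
have tot : ('C(#|W|, k))%:R = \sum_(A in powerset J)
    ('C(#|W| - 2 * d, k - #|A|)%N)%:R :> R.
  rewrite -natr_sum -card_slice; congr (_%:R).
  have := slice_decomp xpredT JW Jk.
  have Tr U l : [set S in slice U l | true] = slice U l.
    by apply/setP => S; rewrite inE andbT.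
  by rewrite Tr => ->; apply: eq_bigr => A _; rewrite Tr card_slice cWJ.
have XP : X \in powerset J by rewrite inE.
rewrite (bigD1 X) //= eqxx add0r (eq_bigr (fun A : {set V} =>
   c ^+ size L * ('C(#|W| - 2 * d, k - #|A|)%N)%:R)); last first.
  by move=> A /andP[_ /negbTE->].
rewrite -mulr_sumr exprSr -mulrA ler_wpM2l ?exprn_ge0 //.
rewrite (bigD1 X) //= cX in tot; rewrite -(lerD2l ('C(#|W| - 2 * d, k - d))%:R) -tot.
have := @leq_bin_remove d #|W| k ltac:(lia) ltac:(lia).
rewrite -(ler_nat R) natrM natrX => hb.
rewrite /c mulrBl mul1r addrCA lerDl subr_ge0.
by rewrite mulrC ler_pdivrMr ?exprn_gt0 // mulrC.
Qed.
End Slice.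

(** * Degree of functions on a slice *)

Section SliceDegree.
Variable V : finType.
Implicit Types (W J A B S : {set V}) (p : seq (V * V)) (f : {set V} -> int).

(** Trading an element of [A :\: B] for one of [B :\: A] brings [A] closer to [B] without leaving
    [W], so comparing neighbours is enough. *)
Lemma exchange_cst (T : Type) (f : {set V} -> T) W (k : nat) :
  (forall S x y, S \subset W -> x \in W -> y \in W -> x != y ->
     x \notin S -> y \notin S -> #|S|.+1 = k -> f (x |: S) = f (y |: S)) ->
  forall A B, A \subset W -> B \subset W -> #|A| = k -> #|B| = k -> f A = f B.
Proof.
move=> h A B; move: {2}#|A :\: B| (leqnn #|A :\: B|) => n.
elim: n A => [|n IH] A nAB AW BW cA cB.
  have AB : A \subset B by rewrite -setD_eq0 -cards_eq0 -leqn0.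
  by have /eqP-> : A == B by rewrite eqEcard AB cA cB /=.
have [AB|] := eqVneq (A :\: B) set0.
  have {}AB : A \subset B by rewrite -setD_eq0 AB.
  by have /eqP-> : A == B by rewrite eqEcard AB cA cB /=.
case/set0Pn => x; rewrite inE => /andP[xB xA].
have [y] : exists y, y \in B :\: A.
  apply/set0Pn; rewrite -card_gt0 cardsD cB -cA setIC -cardsD card_gt0.
  by apply/set0Pn; exists x; rewrite inE xB.
rewrite inE => /andP[yA yB].
have cAx : #|A :\ x|.+1 = k by rewrite -cA (cardsD1 x A) xA.
have xy : x != y by apply: contraNneq yA => <-.
have -> : f A = f (y |: A :\ x).
  rewrite -{1}(setD1K xA); apply: h => //.
  - exact: subset_trans (subD1set _ _) AW.
  - exact: (fintype.subsetP AW).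
  - exact: (fintype.subsetP BW).
  - by rewrite setD11.
  - by rewrite inE (negbTE yA) andbF.
apply: IH => //.
- have : (y |: A :\ x) :\: B \subset (A :\: B) :\ x.
    apply/fintype.subsetP => z; rewrite !inE => /andP[zB /orP[/eqP zy|/andP[-> ->]]].
      by rewrite zy yB in zB.
    by rewrite zB.
  move/subset_leq_card => /leq_trans; apply.
  by move: nAB; rewrite (cardsD1 x) inE xB xA.
- rewrite subUset sub1set (fintype.subsetP BW) //=.
  exact: subset_trans (subD1set _ _) AW.
- by rewrite cardsU1 inE (negbTE yA) andbF.
Qed.

Lemma verts_cons (q : V * V) p :
  perm_eq (verts (q :: p)) (q.1 :: q.2 :: verts p).
Proof.
rewrite /verts /= perm_cons.
exact: (permEl (perm_catCA (map fst p) [:: q.2] (map snd p))).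
Qed.

(** The slice counterpart of iterated derivatives: toggling one vertex would leave the slice, so the
    basic difference exchanges the two vertices of a pair. For an admissible [S], [f] is evaluated
    only at [k]-subsets of [W]. *)
Fixpoint sdiff p f S : int :=
  if p is q :: p' then sdiff p' (fun S => f (q.1 |: S) - f (q.2 |: S)) S
  else f S.

Definition admissible W (k : nat) p S :=
  [&& uniq (verts p), all (mem W) (verts p), S \subset W,
      all (fun v => v \notin S) (verts p) & #|S| + size p == k]%N.

(* [sdlt n W k f]: on the k-subsets of W, f agrees with a polynomial of degree
   less than n in the indicator variables. *)
Definition sdlt (n : nat) W (k : nat) f :=
  forall p S, size p = n -> admissible W k p S -> sdiff p f S = 0.

Lemma eq_sdiff p f g S : f =1 g -> sdiff p f S = sdiff p g S.
Proof.
elim: p f g => [|q p IH] f g e //=.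
by apply: IH => T; rewrite !e.
Qed.

Lemma sdiffB p f g S :
  sdiff p (fun S => f S - g S) S = sdiff p f S - sdiff p g S.
Proof.
elim: p f g => [|q p IH] f g //=; rewrite -IH; apply: eq_sdiff => T; ring.
Qed.

Lemma sdiffU1 p f x S : sdiff p (fun S => f (x |: S)) S = sdiff p f (x |: S).
Proof.
elim: p f => [|q p IH] f //=; rewrite -IH; apply: eq_sdiff => T.
by rewrite !(setUCA [set x]).
Qed.

Lemma sdiffU p f A S : sdiff p (fun S => f (A :|: S)) S = sdiff p f (A :|: S).
Proof.
elim: p f => [|q p IH] f //=; rewrite -IH; apply: eq_sdiff => T.
by rewrite !(setUCA A).
Qed.

(** Exchanging [x] for [y] in the base set changes the difference along [p] by the difference along
    [(x, y) :: p], which has order [n.+1] and vanishes. Base sets are linked by such exchanges. *)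
Lemma sdiff_cst n W k f p S T : sdlt n.+1 W k f -> size p = n ->
  admissible W k p S -> admissible W k p T -> sdiff p f S = sdiff p f T.
Proof.
move=> hf sp /and5P[up pW SW pS /eqP cS] /and5P[_ _ TW pT /eqP cT].
pose W' := W :\: [set v in verts p].
have sub (U : {set V}) : U \subset W -> all (fun v => v \notin U) (verts p) -> U \subset W'.
  move=> UW /allP pU; rewrite subsetD UW /=; apply/pred0P => v /=; rewrite inE.
  by apply/negbTE/andP => -[vU /pU]; rewrite vU.
apply: (@exchange_cst _ (sdiff p f) W' #|S|) => //; try exact: sub; last by lia.
move=> U x y; rewrite /W' subsetD => /andP[UW dU].
rewrite !inE => /andP[xp xW] /andP[yp yW] xy xU yU cU.
apply/eqP; rewrite -subr_eq0 -!sdiffU1 -sdiffB.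
have := hf ((x, y) :: p) U => /= -> //; first by rewrite sp.
have pE : perm_eq (verts ((x, y) :: p)) (x :: y :: verts p).
  exact: verts_cons.
apply/and5P; split=> //.
- by rewrite (perm_uniq pE) /= inE negb_or xy xp yp up.
- by rewrite (perm_all _ pE) /= xW yW.
- rewrite (perm_all _ pE) /= xU yU /=; apply/allP => v vp.
  by rewrite (disjointFl dU) // inE.
- by rewrite /= addnS -addSn cU cS.
Qed.

(** This lowers the degree: order-[n] differences are assumed to vanish only along pairs avoiding
    [J], and once the trace on [J] is fixed no other pairs remain. *)
Lemma sdlt_restrict n W k f J A : A \subset J -> J \subset W ->
  (#|A| <= k)%N -> (forall p S, size p = n -> admissible W k p S ->
     all (fun v => v \notin J) (verts p) -> sdiff p f S = 0) ->
  sdlt n (W :\: J) (k - #|A|) (fun S => f (A :|: S)).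
Proof.
move=> AJ JW Ak h p S sp /and5P[up pW SW pS /eqP cS].
rewrite sdiffU; apply: h => //; last first.
  by apply/allP => v /(allP pW); rewrite !inE => /andP[].
move: SW; rewrite subsetD => /andP[SW dS].
have pJ v : v \in verts p -> v \notin J.
  by move=> /(allP pW); rewrite !inE => /andP[].
apply/and5P; split=> //.
- by apply/allP => v /(allP pW); rewrite !inE => /andP[].
- by rewrite subUset SW (subset_trans AJ JW).
- apply/allP => v vp; rewrite inE negb_or (allP pS) // andbT.
  by apply: contra (pJ v vp); apply: (fintype.subsetP AJ).
- rewrite cardsU disjoint_setI0 ?cards0 ?subn0; last first.
    by rewrite disjoint_sym (disjointWr AJ).
  by rewrite -addnA cS subnKC.
Qed.

Lemma sdlt1_cst W k f S T : sdlt 1 W k f -> S \in slice W k ->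
  T \in slice W k -> f S = f T.
Proof.
rewrite !inE => hf /andP[SW /eqP cS] /andP[TW /eqP cT].
apply: (@exchange_cst _ f W k) => // U x y UW xW yW xy xU yU cU.
apply/eqP; rewrite -subr_eq0; apply/eqP; apply: (hf [:: (x, y)] U) => //.
by rewrite /admissible /= inE xy xW yW UW xU yU addn1 cU eqxx.
Qed.

Lemma sdiffD1 p f x S : x \notin verts p ->
  sdiff p (fun S => f (S :\ x)) S = sdiff p f (S :\ x).
Proof.
elim: p f => [|q p IH] f //= xp.
have [x1 x2] : x != q.1 /\ x != q.2.
  by split; apply: contraNneq xp => ->; rewrite ?verts_fst ?verts_snd // mem_head.
have {}xp : x \notin verts p.
  apply: contra xp; rewrite !mem_cat /= !inE.
  by case/orP=> ->; rewrite !orbT.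
rewrite -IH //; apply: eq_sdiff => T.
have E v : x != v -> (v |: T) :\ x = v |: (T :\ x).
  move=> xv; apply/setP => z; rewrite !inE.
  by have [->|] := eqVneq z x; rewrite //= (negbTE xv).
by rewrite !E.
Qed.

(** An exchange difference is the derivative in [x] minus the derivative in [y], so degree on the
    cube bounds degree on the slice. *)
Lemma sdiff_dlt n f p S : dlt n f -> size p = n -> uniq (verts p) ->
  all (fun v => v \notin S) (verts p) -> sdiff p f S = 0.
Proof.
elim: n f p => [|n IH] f p hf; first by move/size0nil=> ->; rewrite /= hf.
case: p => [//|[x y] p] [sp] up pS.
have pE : perm_eq (verts ((x, y) :: p)) (x :: y :: verts p).
  exact: verts_cons.
move: up pS; rewrite (perm_uniq pE) (perm_all _ pE) /= inE negb_or.
move=> /and3P[/andP[xy xp] yp up] /and3P[xS yS pS].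
have E z : z \notin verts p -> z \notin S ->
    sdiff p (fun S => f (z |: S)) S = sdiff p f S.
  move=> zp zS; have := IH _ p (hf z) sp up pS.
  rewrite /deriv sdiffB sdiffD1 // => /subr0_eq ->.
  by congr (sdiff p f _); apply/setDidPl; rewrite disjoint_sym disjoints1.
by rewrite sdiffB !E ?subrr.
Qed.

End SliceDegree.

(** * Cubes inside a slice *)

Section Transversal.
Variables (I V : finType) (x y : I -> V).
Hypotheses (x_inj : injective x) (y_inj : injective y).
Hypothesis xy_neq : forall i j, x i != y j.
Implicit Types (P Q : {set I}) (W A S : {set V}) (b : {set I}).
Implicit Types (f : {set V} -> int).

(* [A] together with one vertex out of each pair (x i, y i), i in P; the bits
   b select which. *)
Definition pick_sides P A b : {set V} := A :|: x @: (P :&: b) :|: y @: (P :\: b).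

Lemma pick_sides_in i P A b : i \in P ->
  pick_sides P A (i |: b) = x i |: pick_sides (P :\ i) A b.
Proof.
move=> iP; rewrite /pick_sides.
have -> : P :&: (i |: b) = i |: ((P :\ i) :&: b).
  by apply/setP => j; rewrite !inE; have [->|] := eqVneq j i; rewrite ?iP.
have -> : P :\: (i |: b) = (P :\ i) :\: b.
  by apply/setP => j; rewrite !inE; case: eqP; case: (j \in b); case: (j \in P).
by rewrite imsetU1 !setUA [A :|: _]setUC.
Qed.

Lemma pick_sides_out i P A b : i \in P ->
  pick_sides P A (b :\ i) = y i |: pick_sides (P :\ i) A b.
Proof.
move=> iP; rewrite /pick_sides.
have -> : P :&: (b :\ i) = (P :\ i) :&: b.
  by apply/setP => j; rewrite !inE; case: eqP; case: (j \in b); case: (j \in P).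
have -> : P :\: (b :\ i) = i |: ((P :\ i) :\: b).
  by apply/setP => j; rewrite !inE; have [->|] := eqVneq j i; rewrite ?iP.
by rewrite imsetU1 setUCA.
Qed.

Lemma pick_sides_id i P A b : i \notin P ->
  pick_sides P A (i |: b) = pick_sides P A (b :\ i).
Proof.
move=> iP; rewrite /pick_sides.
have -> : P :&: (i |: b) = P :&: (b :\ i).
  by apply/setP => j; rewrite !inE; case: eqP => // ->; rewrite (negbTE iP).
have -> // : P :\: (i |: b) = P :\: (b :\ i).
by apply/setP => j; rewrite !inE; case: eqP => // ->; rewrite (negbTE iP) !andbF.
Qed.

Definition free P A := forall i, i \in P -> x i \notin A /\ y i \notin A.

Lemma in_pick_sides_x P A b i :
  (x i \in pick_sides P A b) = (x i \in A) || (i \in P) && (i \in b).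
Proof.
rewrite !inE mem_imset // inE; case: imsetP => [[j _ e]|_]; last by rewrite orbF.
by have := xy_neq i j; rewrite e eqxx.
Qed.

Lemma in_pick_sides_y P A b i :
  (y i \in pick_sides P A b) = (y i \in A) || (i \in P) && (i \notin b).
Proof.
rewrite !inE [y i \in y @: _]mem_imset // inE andbC [(i \in P) && _]andbC.
case: imsetP => [[j _ e]|_]; last by rewrite orbF.
by have := xy_neq j i; rewrite e eqxx.
Qed.

Lemma card_pick_sides P A b : free P A -> #|pick_sides P A b| = (#|A| + #|P|)%N.
Proof.
move=> h; rewrite /pick_sides cardsU (card_imset _ y_inj) cardsU (card_imset _ x_inj).
rewrite [X in (#|A| + _ - X)%N](_ : _ = 0%N) ?subn0; last first.
  apply/eqP; rewrite cards_eq0; apply/eqP/setP => v; rewrite !inE.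
  apply/negbTE/andP => -[vA /imsetP[i]]; rewrite inE => /andP[iP _] vE.
  by have [] := h i iP; rewrite -vE vA.
rewrite [X in (_ - X)%N](_ : _ = 0%N) ?subn0; last first.
  apply/eqP; rewrite cards_eq0; apply/eqP/setP => v; rewrite !inE.
  apply/negbTE/andP => -[vA /imsetP[i]]; rewrite inE => /andP[_ iP] vE.
  case/orP: vA => [vA|/imsetP[j _ e]]; first by have [_] := h i iP; rewrite -vE vA.
  by have := xy_neq j i; rewrite -e vE eqxx.
by rewrite -addnA cardsID.
Qed.

(** Differentiating in the bit [i] is exchanging [x i] and [y i]; slice degree thus becomes cube
    degree. *)
Lemma dlt_pick_sides n f W (k : nat) P A : sdlt n W k f -> A \subset W ->
  (forall i, i \in P -> x i \in W /\ y i \in W) -> free P A ->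
  (#|A| + #|P| = k)%N -> dlt n (fun b => f (pick_sides P A b)).
Proof.
elim: n f W k P => [|n IH] f W k P hf AW PW AP c.
  move=> b; apply: (hf [::]) => //; apply/and5P; split=> //.
    rewrite /pick_sides !subUset AW; apply/andP; split.
      by apply/fintype.subsetP => _ /imsetP[i /setIP[iP _] ->]; case: (PW i iP).
    by apply/fintype.subsetP => _ /imsetP[i /setDP[iP _] ->]; case: (PW i iP).
  by rewrite addn0 card_pick_sides // c.
move=> i /=; have [iP|iP] := boolP (i \in P); last first.
  by apply: dlt0 => b; rewrite /deriv pick_sides_id ?subrr.
apply: (@eq_dlt _ _ (fun b => (fun S => f (x i |: S) - f (y i |: S))
    (pick_sides (P :\ i) A b))).
  by move=> b; rewrite /deriv pick_sides_in ?pick_sides_out.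
have [xW yW] := PW i iP; have [xA yA] := AP i iP.
apply: (IH (fun S => f (x i |: S) - f (y i |: S)) (W :\ x i :\ y i) k.-1).
- move=> p S sp /and5P[up pW SW pS /eqP cS].
  apply: (hf ((x i, y i) :: p)); first by rewrite /= sp.
  have pE := verts_cons (x i, y i) p.
  have pW' v : v \in verts p -> [&& v != y i, v != x i & v \in W].
    by move=> /(allP pW); rewrite !inE.
  move: SW; rewrite !subsetD1 => /andP[/andP[SW xS] yS].
  apply/and5P; split=> //.
  + rewrite (perm_uniq pE) /= inE negb_or xy_neq up andbT /=.
    by apply/andP; split; apply/negP => /pW'; rewrite eqxx ?andbF.
  + rewrite (perm_all _ pE) /= xW yW /=; apply/allP => v /pW'.
    by case/and3P.
  + by rewrite (perm_all _ pE) /= xS yS.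
  + by rewrite /= addnS cS prednK // -c (cardsD1 i P) iP addnS.
- by rewrite !subsetD1 AW xA yA.
- move=> j /setD1P[ji jP]; have [xjW yjW] := PW j jP; rewrite !inE xjW yjW.
  by rewrite xy_neq [y j == x i]eq_sym xy_neq (inj_eq x_inj) (inj_eq y_inj) ji.
- by move=> j /setD1P[_ /AP].
- by rewrite -c (cardsD1 i P) iP addnS.
Qed.

Lemma derivs_pick_sides e f P A b : uniq e -> {subset e <= P} ->
  derivs e (fun b => f (pick_sides P A b)) b =
  sdiff [seq (x i, y i) | i <- e] f (pick_sides (P :\: [set i in e]) A b).
Proof.
elim: e f P => [|i e IH] f P /=.
  move=> _ _; congr (f (pick_sides _ _ _)).
  by apply/setP => i; rewrite !inE.
move=> /andP[ie ue] eP; have iP : i \in P by rewrite eP ?mem_head.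
rewrite (@eq_derivs _ _ _ (fun b => (fun S => f (x i |: S) - f (y i |: S))
    (pick_sides (P :\ i) A b))); last first.
  by move=> c; rewrite /deriv pick_sides_in ?pick_sides_out.
rewrite (IH (fun S => f (x i |: S) - f (y i |: S))) //; last first.
  move=> j je; rewrite !inE eP ?inE ?je ?orbT // andbT.
  by apply: contraNneq ie => <-.
congr (sdiff _ _ (pick_sides _ _ _)).
by apply/setP => j; rewrite !inE negb_or andbCA andbA.
Qed.

Definition split_idx S := [set i | (x i \in S) (+) (y i \in S)].

Definition core S := S :\: (x @: split_idx S :|: y @: split_idx S).

Definition resample S b := pick_sides (split_idx S) (core S) b.

Lemma free_core S : free (split_idx S) (core S).
Proof. by move=> i iS; rewrite !in_setD !in_setU !imset_f ?orbT. Qed.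

Lemma core_subset S : core S \subset S. Proof. exact: subsetDl. Qed.

Lemma resample_x S b i : (x i \in resample S b) =
  if i \in split_idx S then i \in b else x i \in S.
Proof.
rewrite in_pick_sides_x; case: ifPn => iS /=.
  by have [/negbTE->] := free_core iS.
rewrite orbF inE [x i \in _ :|: _]inE (mem_imset _ _ x_inj) (negbTE iS) /=.
case: imsetP => [[j _ e]|//].
by have := xy_neq i j; rewrite e eqxx.
Qed.

Lemma resample_y S b i : (y i \in resample S b) =
  if i \in split_idx S then i \notin b else y i \in S.
Proof.
rewrite in_pick_sides_y; case: ifPn => iS /=.
  by have [_ /negbTE->] := free_core iS.
rewrite orbF inE [y i \in _ :|: _]inE (mem_imset _ _ y_inj) (negbTE iS) orbF.
case: imsetP => [[j _ e]|//].
by have := xy_neq j i; rewrite e eqxx.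
Qed.

Lemma resample_other S b v : v \notin codom x -> v \notin codom y ->
  (v \in resample S b) = (v \in S).
Proof.
move=> vx vy.
have nx Q : v \in x @: Q = false.
  by apply/imsetP => -[i _ e]; rewrite e codom_f in vx.
have ny Q : v \in y @: Q = false.
  by apply/imsetP => -[i _ e]; rewrite e codom_f in vy.
by rewrite /resample /pick_sides /core !inE !nx !ny !orbF.
Qed.

Lemma split_resample S b : split_idx (resample S b) = split_idx S.
Proof.
apply/setP => i; rewrite [LHS]inE resample_x resample_y.
by case: ifPn => [_|]; [case: (i \in b) | rewrite inE => /negbTE].
Qed.

Lemma resample_ext S (T : {set V}) :
  (forall i, x i \in S = (x i \in T)) -> (forall i, y i \in S = (y i \in T)) ->
  (forall v, v \notin codom x -> v \notin codom y -> (v \in S) = (v \in T)) ->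
  S = T.
Proof.
move=> hx hy ho; apply/setP => v.
have [/codomP[i ->]//|vx] := boolP (v \in codom x).
have [/codomP[i ->]//|vy] := boolP (v \in codom y).
exact: ho.
Qed.

(** What [resample S b] forgets: the old orientation of the split pairs, stored in the bits of [b]
    that have been consumed. This makes [(S, b) |-> (resample S b, orient S b)] an involution. *)
Definition orient S b := [set i | if i \in split_idx S then x i \in S else i \in b].

Lemma in_orient S b i :
  (i \in orient S b) = if i \in split_idx S then x i \in S else i \in b.
Proof. by rewrite [i \in orient S b]inE. Qed.

Lemma split_idx_snd S i : i \in split_idx S -> (y i \in S) = (x i \notin S).
Proof. by rewrite inE; case: (x i \in S); case: (y i \in S). Qed.

Lemma resampleK S b : resample (resample S b) (orient S b) = S.
Proof.
apply: resample_ext => [i|i|v vx vy].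
- rewrite resample_x split_resample in_orient resample_x.
  by case: (i \in split_idx S).
- rewrite resample_y split_resample in_orient resample_y.
  by have [/split_idx_snd->|] := boolP (i \in split_idx S).
- by rewrite !resample_other.
Qed.

Lemma orientK S b : orient (resample S b) (orient S b) = b.
Proof.
apply/setP => i; rewrite in_orient split_resample resample_x in_orient.
by case: (i \in split_idx S).
Qed.

Lemma resample_orient S b : resample S (orient S b) = S.
Proof.
apply: resample_ext => [i|i|v vx vy]; last by rewrite resample_other.
  by rewrite resample_x in_orient; case: (i \in split_idx S).
rewrite resample_y in_orient.
by have [/split_idx_snd->|] := boolP (i \in split_idx S).
Qed.

Lemma card_core S : (#|core S| + #|split_idx S|)%N = #|S|.
Proof.
rewrite -[in RHS](resample_orient S set0).
by rewrite card_pick_sides //; apply: free_core.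
Qed.

Lemma resample_slice W (k : nat) S b : (forall i, x i \in W /\ y i \in W) ->
  S \in slice W k -> resample S b \in slice W k.
Proof.
move=> xyW; rewrite !inE => /andP[SW /eqP <-].
rewrite card_pick_sides ?card_core ?eqxx ?andbT; last exact: free_core.
rewrite /resample /pick_sides !subUset (subset_trans (core_subset S) SW).
apply/andP; split; apply/fintype.subsetP => v /imsetP[i _ ->];
  by case: (xyW i).
Qed.

(** The involution preserves the uniform measure on pairs [(S, b)], so resampling a uniform [S]
    leaves it uniform. *)
Lemma sum_prob_resample (R : archiRealFieldType) W (k : nat)
    (P : pred {set V}) : (forall i, x i \in W /\ y i \in W) ->
  #|[set S in slice W k | P S]|%:R =
  \sum_(S in slice W k) prob R (fun b => P (resample S b)).
Proof.
move=> xyW.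
transitivity (\sum_(S in slice W k) mean (fun b : {set I} => (P S)%:R : R)).
  rewrite -sum1_card natr_sum (eq_bigl (fun S => (S \in slice W k) && P S)).
    rewrite big_mkcondr; apply: eq_bigr => S _; rewrite mean_cst.
    by case: (P S).
  by move=> S; rewrite inE.
rewrite /prob /mean -!mulr_sumr; congr (_ * _).
rewrite !pair_big_dep /=.
pose h (p : {set V} * {set I}) := (resample p.1 p.2, orient p.1 p.2).
have hK : involutive h.
  by case=> S b; rewrite /h /= resampleK orientK.
rewrite [RHS](reindex_inj (inv_inj hK)) /=; apply: eq_big => [[S b]|[S b] _] /=.
  rewrite !andbT; apply/idP/idP; first exact: resample_slice.
  by move/(resample_slice (orient S b) xyW); rewrite resampleK.
by rewrite resampleK.
Qed.

End Transversal.

(** * Anticoncentration on a slice with many disjoint boxes *)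

Lemma uniq_flatten_map (T : eqType) (s : seq nat) (F : nat -> seq T) :
  uniq s -> {in s, forall i, uniq (F i)} ->
  {in s &, forall i j, {in F i, forall v, v \in F j -> i = j}} ->
  uniq (flatten (map F s)).
Proof.
elim: s => //= i s IH /andP[iNs us] uF dF; rewrite cat_uniq uF ?mem_head //=.
apply/andP; split.
  apply/hasPn => v /flattenP[_ /mapP[j js ->] vj]; apply/negP => vi.
  have ij := dF i j (mem_head _ _) _ v vi vj.
  by rewrite ij ?js // inE js orbT in iNs.
apply: IH => // [j js|j l js ls]; first by rewrite uF // inE js orbT.
by apply: dF; rewrite inE ?js ?ls orbT.
Qed.

Lemma derivsB (I : finType) (e : seq I) (F G : {set I} -> int) :
  derivs e (fun b => F b - G b) =1 (fun b => derivs e F b - derivs e G b).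
Proof.
elim: e F G => //= i e IH F G b; rewrite -IH; apply: eq_derivs => c.
rewrite /deriv; ring.
Qed.

Lemma derivs_cst (I : finType) (e : seq I) (c : int) : (0 < size e)%N ->
  derivs e (fun=> c) =1 fun=> 0.
Proof.
case: e => // i e _ b /=.
rewrite (@eq_derivs _ _ _ (fun=> 0)); last by move=> d; rewrite /deriv subrr.
by elim: e => //= j e <-; apply: eq_derivs => d; rewrite /deriv subrr.
Qed.

Section ManyBoxes.
Variables (R : archiRealFieldType) (V : finType) (d m n : nat).
Variables (f : {set V} -> int) (W : {set V}) (k : nat).
Let M := (m * n)%N.
Variable p : nat -> (d.+1).-tuple (V * V).
Hypothesis f_deg : sdlt d.+2 W k f.
Hypothesis p_uniq : forall i, (i < M)%N -> uniq (verts (p i)).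
Hypothesis p_sub : forall i, (i < M)%N -> {subset verts (p i) <= W}.
Hypothesis p_disj : forall i j, (i < M)%N -> (j < M)%N ->
  {in verts (p i), forall v, v \in verts (p j) -> i = j}.
Hypothesis p_active : forall i, (i < M)%N ->
  exists2 S, admissible W k (p i) S & sdiff (p i) f S != 0.

Let I := ('I_M * 'I_d.+1)%type.
Let x (i : I) := (tnth (p i.1) i.2).1.
Let y (i : I) := (tnth (p i.1) i.2).2.

Let x_in (i : I) : x i \in verts (p i.1).
Proof. exact/verts_fst/mem_tnth. Qed.

Let y_in (i : I) : y i \in verts (p i.1).
Proof. exact/verts_snd/mem_tnth. Qed.

Let tnth_fst (i : I) v0 : x i = nth v0 (map fst (p i.1)) i.2.
Proof.
by rewrite (nth_map (v0, v0)) ?size_tuple // /x (tnth_nth (v0, v0)).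
Qed.

Let tnth_snd (i : I) v0 : y i = nth v0 (map snd (p i.1)) i.2.
Proof.
by rewrite (nth_map (v0, v0)) ?size_tuple // /y (tnth_nth (v0, v0)).
Qed.

Let x_inj : injective x.
Proof.
move=> i j e; have ij : i.1 = j.1.
  by apply/val_inj/(p_disj (ltn_ord _) (ltn_ord _) (x_in i)); rewrite e x_in.
have := p_uniq (ltn_ord i.1); rewrite cat_uniq => /and3P[u _ _].
move/eqP: e; rewrite (tnth_fst i (x i)) (tnth_fst j (x i)) -ij.
rewrite nth_uniq ?size_map ?size_tuple // => /eqP e.
by case: i j ij e {u} => [? ?] [? ?] /= -> /val_inj->.
Qed.

Let y_inj : injective y.
Proof.
move=> i j e; have ij : i.1 = j.1.
  by apply/val_inj/(p_disj (ltn_ord _) (ltn_ord _) (y_in i)); rewrite e y_in.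
have := p_uniq (ltn_ord i.1); rewrite cat_uniq => /and3P[_ _ u].
move/eqP: e; rewrite (tnth_snd i (x i)) (tnth_snd j (x i)) -ij.
rewrite nth_uniq ?size_map ?size_tuple // => /eqP e.
by case: i j ij e {u} => [? ?] [? ?] /= -> /val_inj->.
Qed.

Let xy_neq i j : x i != y j.
Proof.
apply/eqP => e; have ij : i.1 = j.1.
  by apply/val_inj/(p_disj (ltn_ord _) (ltn_ord _) (x_in i)); rewrite e y_in.
have := p_uniq (ltn_ord i.1); rewrite cat_uniq => /and3P[_ /hasPn h _].
have /h/negP[] : y j \in map snd (p i.1) by rewrite ij; apply: (map_f snd (mem_tnth _ _)).
by rewrite -e; apply: (map_f fst (mem_tnth _ _)).
Qed.

Let xyW i : x i \in W /\ y i \in W.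
Proof. by rewrite !(p_sub (ltn_ord i.1)). Qed.

Let box_idx (i : 'I_M) : seq I := [seq (i, a) | a <- enum 'I_d.+1].

Let box_idxE i : [seq (x j, y j) | j <- box_idx i] = p i.
Proof.
rewrite -map_comp -[RHS]map_tnth_enum; apply: eq_map => a /=.
by rewrite /x /y /=; case: (tnth _ _).
Qed.

Let box_idx_uniq i : uniq (box_idx i).
Proof. by rewrite map_inj_uniq ?enum_uniq // => a b []. Qed.

Let size_box_idx i : size (box_idx i) = d.+1.
Proof. by rewrite size_map size_enum_ord. Qed.

Let splits_idx (i : 'I_M) S : splits (p i) S = all (mem (split_idx x y S)) (box_idx i).
Proof.
rewrite -[in LHS]box_idxE /splits all_map; apply: eq_all => j /=.
by rewrite !inE.
Qed.

(** When [S] splits the box, this derivative is a top-order exchange difference along [p i]. By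
    [sdiff_cst] it does not depend on the base set, so it equals the nonzero one provided by
    [p_active]. *)
Lemma box_deriv S (i : 'I_M) : S \in slice W k -> splits (p i) S ->
  derivs (box_idx i) (fun b => f (resample x y S b)) set0 != 0.
Proof.
rewrite inE => /andP[SW /eqP cS]; rewrite splits_idx => /allP sp.
have [S0 adm] := p_active (ltn_ord i).
rewrite (@derivs_pick_sides _ _ x y) ?box_idxE //.
apply: contraNneq => <-.
have [up _ _ _ _] := and5P adm.
apply/eqP; apply: (sdiff_cst f_deg) => //; first by rewrite size_tuple.
have fr : free x y (split_idx x y S) (core x y S) by apply: free_core.
set P := _ :\: _; have frP : free x y P (core x y S).
  by move=> j /setDP[jS _]; apply: fr.
have nP j : j \in box_idx i -> j \notin P.
  by move=> ji; rewrite in_setD [j \in [set _ in _]]inE ji.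
have cW : core x y S \subset W by apply: subset_trans (core_subset _ _ _) SW.
apply/and5P; split=> //.
- by apply/allP => v; apply: p_sub.
- rewrite /pick_sides !subUset cW.
  by apply/andP; split; apply/fintype.subsetP => v /imsetP[j _ ->]; case: (xyW j).
- apply/allP => v; rewrite mem_cat -box_idxE.
  move=> /orP[] /mapP[_ /mapP[j ji ->] ->] /=.
    by rewrite in_pick_sides_x // (negbTE (nP j ji)) orbF; have [] := fr j (sp j ji).
  by rewrite in_pick_sides_y // (negbTE (nP j ji)) orbF; have [] := fr j (sp j ji).
- rewrite card_pick_sides // -addnA; apply/eqP; rewrite -cS -(card_core x_inj y_inj xy_neq S).
  congr (_ + _)%N; rewrite -[RHS](cardsID [set j in box_idx i]) addnC.
  congr (_ + _)%N.
  have -> : split_idx x y S :&: [set j in box_idx i] = [set j in box_idx i].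
    by apply/setIidPr/fintype.subsetP => j; rewrite inE => /sp.
  by rewrite cardsE (card_uniqP (box_idx_uniq i)) size_box_idx size_tuple.
Qed.

Let good S := [forall g : 'I_m, [exists c : 'I_n, splits (p (g * n + c)%N) S]].

Let idx_lt (g : 'I_m) (c : 'I_n) : (g * n + c < M)%N.
Proof.
apply: (@leq_trans (g * n + n)%N); first by rewrite ltn_add2l.
by rewrite addnC -mulSn leq_mul2r ltn_ord orbT.
Qed.

(** The boxes form [m] groups of [n]. A group contains no box split by [S] with probability at most
    [(1 - 16 ^- d.+1) ^ n]. Otherwise one split box per group gives [m] disjoint nonzero monomials
    of the resampled function; resampling does not alter which boxes are split. *)
Lemma card_many_boxes (delta : R) (l : int) : 0 <= delta ->
  (forall (F : {set I} -> int) (e : nat -> seq I), dlt d.+2 F ->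
    (forall i, (i < m)%N ->
       [/\ size (e i) = d.+1, uniq (e i) & derivs (e i) F set0 != 0]) ->
    (forall i j, (i < m)%N -> (j < m)%N -> i != j -> ~~ has (mem (e i)) (e j)) ->
    prob R (fun b => F b == 0) <= delta) ->
  (#|W| + 8 * d.+1 * n <= 4 * k)%N -> (4 * k + 8 * d.+1 * n <= 3 * #|W|)%N ->
  #|[set S in slice W k | f S == l]|%:R <=
    (delta + m%:R * (1 - (16 ^+ d.+1)^-1) ^+ n) * ('C(#|W|, k))%:R :> R.
Proof.
move=> delta0 anti h1 h2.
pose bad (g : 'I_m) S := all (fun q : seq (V * V) => ~~ splits q S)
  [seq tval (p i) | i <- iota (g * n) n].
have badP g S : bad g S = ~~ [exists c : 'I_n, splits (p (g * n + c)%N) S].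
  rewrite negb_exists; apply/allP/forallP => [h c|h q /mapP[i]].
    by apply: h; apply: map_f; rewrite mem_iota leq_addr ltn_add2l /=.
  rewrite mem_iota => /andP[i1 i2] ->; have cn : (i - g * n < n)%N by lia.
  by have := h (Ordinal cn); rewrite /= subnKC.
have card_bad g : #|[set S in slice W k | bad g S]|%:R <=
    (1 - (16 ^+ d.+1)^-1) ^+ n * ('C(#|W|, k))%:R :> R.
  set L := [seq tval (p i) | i <- iota (g * n) n].
  have sL : size L = n by rewrite size_map size_iota.
  have LM i : i \in iota (g * n) n -> (i < M)%N.
    rewrite mem_iota => /andP[i1 i2]; have cn : (i - g * n < n)%N by lia.
    by have := idx_lt g (Ordinal cn); rewrite /= subnKC.
  rewrite -{1}sL; apply: card_unsplit; rewrite ?sL //.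
  - rewrite -map_comp; apply: uniq_flatten_map; rewrite ?iota_uniq //.
      by move=> i /LM; apply: p_uniq.
    by move=> i j /LM iM /LM jM; apply: p_disj.
  - by apply/allP => q /mapP[i _ ->]; rewrite size_tuple.
  - by move=> v /flattenP[_ /mapP[_ /mapP[i /LM iM ->] ->]]; apply: p_sub.
have card_good : #|[set S in slice W k | good S && (f S == l)]|%:R <=
    delta * ('C(#|W|, k))%:R :> R.
  rewrite (sum_prob_resample x_inj y_inj xy_neq R k _ xyW).
  rewrite -card_slice mulr_natr -sumr_const; apply: ler_sum => S Sk.
  have goodE b : good (resample x y S b) = good S.
    apply: eq_forallb => g; apply: eq_existsb => c.
    have := splits_idx (Ordinal (idx_lt g c)) => /= spE.
    by rewrite !spE split_resample.
  have [gS|gS] := boolP (good S); last first.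
    rewrite (_ : prob _ _ = 0) // -[RHS](mean_cst I (0 : R)).
    by apply: eq_mean => b; rewrite goodE (negbTE gS).
  have /fin_all_exists[c hc] (g : 'I_m) : exists c : 'I_n,
      splits (p (g * n + c)%N) S.
    by move/forallP: gS => /(_ g) /existsP.
  pose sel (g : nat) : seq I := if insub g is Some o
    then box_idx (Ordinal (idx_lt o (c o))) else [::].
  have selE g (gm : (g < m)%N) : sel g =
      box_idx (Ordinal (idx_lt (Ordinal gm) (c (Ordinal gm)))).
    by rewrite /sel insubT.
  apply: le_trans (anti (fun b => f (resample x y S b) - l) sel _ _ _).
  - by apply: le_prob => b /andP[_ /eqP->]; rewrite subrr.
  - apply: dltB; last exact: dlt_cst.
    move: Sk; rewrite inE => /andP[SW /eqP cS].
    apply: (dlt_pick_sides x_inj y_inj xy_neq f_deg) => //.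
    + exact: subset_trans (core_subset _ _ _) SW.
    + exact: free_core.
    + by rewrite card_core.
  - move=> g gm; rewrite (selE g gm) size_box_idx box_idx_uniq; split=> //.
    rewrite derivsB derivs_cst ?size_box_idx // subr0.
    by apply: box_deriv => //; apply: (hc (Ordinal gm)).
  - move=> g g' gm gm'; apply: contra => /hasP[j].
    rewrite (selE g gm) (selE g' gm') => /mapP[a _ ->] /mapP[a' _] [e _].
    move: e => /(congr1 (divn^~ n)).
    rewrite !divnMDl ?(leq_ltn_trans (leq0n _) (ltn_ord (c (Ordinal gm)))) //.
    by rewrite !divn_small ?ltn_ord // !addn0 => ->.
rewrite mulrDl; apply: (@le_trans _ _
    (#|[set S in slice W k | good S && (f S == l)]|%:R
     + \sum_(g < m) #|[set S in slice W k | bad g S]|%:R)).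
  rewrite -natr_sum -natrD ler_nat.
  apply: (@leq_trans #|[set S in slice W k | good S && (f S == l)]
     :|: \bigcup_(g < m) [set S in slice W k | bad g S]|).
    apply/subset_leq_card/fintype.subsetP => S; rewrite inE => /andP[Sk fS].
    rewrite in_setU inE Sk fS andbT /=; case: (boolP (good S)) => //= gS.
    move: gS; rewrite negb_forall => /existsP[g hg].
    by apply/bigcupP; exists g => //; rewrite inE badP hg andbT.
  rewrite cardsU; apply: leq_trans (leq_subr _ _) _; rewrite leq_add2l.
  elim/big_ind2: _ => [|A a B b hA hB|//]; first by rewrite cards0.
  by rewrite cardsU; apply: leq_trans (leq_subr _ _) _; apply: leq_add.
apply: lerD => //; rewrite -mulrA mulr_natl -[m in _ *+ m]card_ord -sumr_const.
by apply: ler_sum => g _.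
Qed.
End ManyBoxes.

(** * Fixing the trace on boundedly many vertices *)

Lemma geometric_small (R : archiRealFieldType) (q d : R) : 0 < q <= 1 ->
  0 < d -> exists n, (1 - q) ^+ n <= d.
Proof.
move=> /andP[q0 q1] d0.
have B n : (1 - q) ^+ n * (1 + n%:R * q) <= 1.
  elim: n => [|n IH]; first by rewrite mul0r addr0 mul1r.
  have e0 : 0 <= (1 - q) ^+ n by rewrite exprn_ge0 // subr_ge0.
  rewrite exprSr -natr1; apply: le_trans IH; rewrite -mulrA ler_wpM2l //.
  have n0 : 0 <= n%:R :> R by [].
  have : 0 <= n%:R * q * q by rewrite !mulr_ge0 // ltW.
  by have := sqr_ge0 q; rewrite expr2; lra.
exists (Num.bound (d^-1 / q)); set n := Num.bound _.
have hn : d^-1 / q < n%:R.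
  by apply: archi_boundP; rewrite divr_ge0 ?invr_ge0 // ltW.
move: hn; rewrite ltr_pdivrMr // => hn.
have e0 : 0 <= (1 - q) ^+ n by rewrite exprn_ge0 // subr_ge0.
have h : (1 - q) ^+ n * d^-1 <= 1.
  apply: le_trans (B n); apply: ler_wpM2l => //; lra.
by move: h; rewrite ler_pdivrMr // mul1r.
Qed.

(** Greedy choice: while some box with a nonzero difference avoids the set [J] of vertices used so
    far, it is added, at the price of [2 * d] vertices; otherwise [J] is the cover. *)
Lemma boxes_or_cover (V : finType) (v0 : V) (d : nat) (f : {set V} -> int)
    (W : {set V}) (k n : nat) :
  (exists p : nat -> d.-tuple (V * V),
     [/\ forall i, (i < n)%N -> uniq (verts (p i)),
         forall i, (i < n)%N -> {subset verts (p i) <= W},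
         forall i j, (i < n)%N -> (j < n)%N ->
           {in verts (p i), forall v, v \in verts (p j) -> i = j}
       & forall i, (i < n)%N ->
           exists2 S, admissible W k (p i) S & sdiff (p i) f S != 0]) \/
  (exists J : {set V}, [/\ J \subset W, (#|J| <= 2 * d * n)%N &
     forall p S, size p = d -> admissible W k p S ->
       all (fun v => v \notin J) (verts p) -> sdiff p f S = 0]).
Proof.
suff: (exists (p : nat -> d.-tuple (V * V)) (J : {set V}),
     [/\ forall i, (i < n)%N -> uniq (verts (p i)),
         forall i, (i < n)%N -> {subset verts (p i) <= J},
         forall i j, (i < n)%N -> (j < n)%N ->
           {in verts (p i), forall v, v \in verts (p j) -> i = j},
         forall i, (i < n)%N ->
           exists2 S, admissible W k (p i) S & sdiff (p i) f S != 0
       & (J \subset W) && (#|J| <= 2 * d * n)%N]) \/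
  (exists J : {set V}, [/\ J \subset W, (#|J| <= 2 * d * n)%N &
     forall p S, size p = d -> admissible W k p S ->
       all (fun v => v \notin J) (verts p) -> sdiff p f S = 0]).
  case=> [[p [J [h1 h2 h3 h4 /andP[JW _]]]]|]; [left; exists p | by right].
  by split=> // i /h2 h v /h; apply: (fintype.subsetP JW).
elim: n => [|n [[p [J [h1 h2 h3 h4 /andP[JW cJ]]]]|[J [JW cJ hJ]]]].
- by left; exists (fun=> [tuple of nseq d (v0, v0)]), set0; rewrite sub0set cards0.
- have [/existsP[q /existsP[S /and3P[adm dS qJ]]]|none] := boolP
    [exists q : d.-tuple (V * V), [exists S, [&& admissible W k q S,
      sdiff q f S != 0 & all (fun v => v \notin J) (verts q)]]]; last first.
    right; exists J; split=> //; first by rewrite (leq_trans cJ) // leq_mul2l leqnSn orbT.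
    move=> r S sr adm rJ; apply/eqP; apply: contraNT none => dS.
    have rd : size r == d by apply/eqP.
    by apply/existsP; exists (Tuple rd); apply/existsP; exists S; rewrite adm dS.
  left; have /and5P[uq qW _ _ _] := adm.
  exists (fun i => if i == n then q else p i), (J :|: [set v in verts q]); split.
  + by move=> i; rewrite ltnS leq_eqVlt; case: eqP => //= _ /h1.
  + move=> i; rewrite ltnS leq_eqVlt; case: eqP => /= _ => [_|/h2 h] v vi.
      by rewrite !inE vi orbT.
    by rewrite inE h.
  + move=> i j; rewrite !ltnS [(i <= n)%N]leq_eqVlt [(j <= n)%N]leq_eqVlt.
    case: eqP => /= [->|_] hi; case: eqP => /= [-> //|_] hj v vi vj.
    * by have := allP qJ v vi; rewrite (h2 j hj v vj).
    * by have := allP qJ v vj; rewrite (h2 i hi v vi).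
    * exact: h3 hi hj v vi vj.
  + move=> i; rewrite ltnS leq_eqVlt; case: eqP => //= _ => [_|/h4//].
    by exists S.
  + rewrite subUset JW /=; apply/andP; split.
      by apply/fintype.subsetP => v; rewrite inE => /(allP qW).
    rewrite mulnS addnC; apply: leq_trans (leq_card_setU _ _) _.
    rewrite leq_add // cardsE; apply: leq_trans (card_size _) _.
    by rewrite size_verts size_tuple.
- right; exists J; split=> //; by rewrite (leq_trans cJ) // leq_mul2l leqnSn orbT.
Qed.

Section Structure.
Variable R : archiRealFieldType.

(** The traces on [J] partition the slice, so some fibre is at least as dense as the average. *)
Lemma dense_fiber (V : finType) (W J : {set V}) (k : nat) (P : pred {set V})
    (eps : R) : J \subset W -> (#|J| <= k)%N ->
  eps * ('C(#|W|, k))%:R <= #|[set S in slice W k | P S]|%:R ->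
  exists2 A : {set V}, A \subset J & eps * ('C(#|W :\: J|, k - #|A|)%N)%:R
    <= #|[set S in slice (W :\: J) (k - #|A|) | P (A :|: S)]|%:R.
Proof.
move=> JW Jk; rewrite (slice_decomp P JW Jk).
have -> : 'C(#|W|, k) = (\sum_(A in powerset J) 'C(#|W :\: J|, k - #|A|))%N.
  have Tr (U : {set V}) l : [set S in slice U l | true] = slice U l.
    by apply/setP => S; rewrite inE andbT.
  rewrite -card_slice -Tr (slice_decomp xpredT JW Jk).
  by apply: eq_bigr => A _; rewrite Tr card_slice.
rewrite !natr_sum mulr_sumr => h.
have [/existsP[A /andP[AJ hA]]|] := boolP [exists A : {set V}, (A \subset J) &&
    (eps * ('C(#|W :\: J|, k - #|A|)%N)%:R
    <= #|[set S in slice (W :\: J) (k - #|A|) | P (A :|: S)]|%:R)].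
  by exists A.
rewrite negb_exists => /forallP no.
suff : \sum_(A in powerset J)
     #|[set S in slice (W :\: J) (k - #|A|) | P (A :|: S)]|%:R <
   \sum_(A in powerset J) eps * ('C(#|W :\: J|, k - #|A|)%N)%:R.
  by rewrite ltNge h.
apply: ltr_sum => [|A]; first by apply/hasP; exists set0; rewrite ?mem_index_enum // inE sub0set.
by rewrite inE => AJ; have := no A; rewrite AJ /= -ltNge.
Qed.

(* Either there are many disjoint boxes with nonzero top-order difference, and
   anticoncentration applies to the cubes they span, or few vertices J meet all
   such boxes, and fixing the trace on J lowers the degree. *)
Theorem slice_structure (d : nat) (eps : R) (c0 : nat) : 0 < eps ->
  exists c k0 : nat, forall (V : finType) (W : {set V}) (f : {set V} -> int)
    (k : nat) (l : int), (k0 <= k)%N ->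
    (#|W| <= 2 * k + c0)%N -> (2 * k <= #|W| + c0)%N ->
    sdlt d.+1 W k f ->
    eps * ('C(#|W|, k))%:R <= #|[set S in slice W k | f S == l]|%:R ->
    exists J A : {set V}, [/\ A \subset J, J \subset W, (#|J| <= c)%N &
      {in slice (W :\: J) (k - #|A|), forall S, f (A :|: S) = l}].
Proof.
have margins (w k k1 c D E : nat) : (k1 + D + 4 * c + E + 1 <= k)%N ->
    (w <= 2 * k + c)%N -> (2 * k <= w + c)%N ->
    [/\ (0 < w)%N, (k <= w)%N, (D <= k)%N, (w + E <= 4 * k)%N
      & (4 * k + E <= 3 * w)%N] by move=> *; split; lia.
have shift (w k k1 c D E a j : nat) : (k1 + D + 4 * c + E + 1 <= k)%N ->
    (w <= 2 * k + c)%N -> (2 * k <= w + c)%N -> (a <= j)%N -> (j <= D)%N ->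
    (j <= w)%N ->
    [/\ (k1 <= k - a)%N, (w - j <= 2 * (k - a) + (c + D))%N
      & (2 * (k - a) <= w - j + (c + D))%N] by move=> *; split; lia.
move=> eps0; elim: d c0 => [|d IH] c0.
  exists 0%N, c0 => V W f k l k0 h1 h2 fdeg dens.
  have /card_gt0P[S0] : (0 < #|[set S in slice W k | f S == l]|)%N.
    rewrite -(ltr0n R); apply: lt_le_trans dens.
    by rewrite mulr_gt0 // ltr0n bin_gt0; lia.
  rewrite inE => /andP[S0k /eqP fS0].
  exists set0, set0; split; rewrite ?sub0set ?cards0 // => S.
  by rewrite setD0 subn0 set0U => Sk; rewrite -fS0; apply: sdlt1_cst Sk S0k.
have e4 : 0 < eps / 4 by rewrite divr_gt0.
have [m hm] := poly_anticoncentration d.+1 e4.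
have q01 : 0 < ((16 : R) ^+ d.+1)^-1 <= 1.
  by rewrite invr_gt0 exprn_gt0 //= invf_le1 ?exprn_gt0 // exprn_ege1 // ler1n.
(* The [m] groups together fail with probability at most [eps / 4]; with the anticoncentration bound
   [eps / 4] this stays below the assumed density [eps]. *)
have [n hn] := geometric_small q01 (divr_gt0 e4 (ltr0Sn R m)).
pose D := (2 * d.+1 * (m * n))%N.
(* Removing [J] from [W] and [#|A|] from [k] changes [#|W| - 2 * k] by at most [#|J|], hence by at
   most [D]. *)
have [c1 [k1 H]] := IH (c0 + D)%N.
exists (c1 + D)%N, (k1 + D + 4 * c0 + 8 * d.+1 * n + 1)%N.
move=> V W f k l hk h1 h2 fdeg dens.
have [w0 kw Dk m1 m2] := margins _ _ _ _ _ _ hk h1 h2.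
have [v0 v0W] : exists v0, v0 \in W by apply/set0Pn; rewrite -card_gt0.
have Cgt0 : 0 < ('C(#|W|, k))%:R :> R by rewrite ltr0n bin_gt0.
have [[p [p1 p2 p3 p4]]|[J [JW cJ hJ]]] := boxes_or_cover v0 d.+1 f W k (m * n).
  have ub := card_many_boxes fdeg p1 p2 p3 p4 l (ltW e4) (hm _) m1 m2.
  have := le_trans dens ub; rewrite ler_pM2r // => ub'.
  have : m%:R * (1 - (16 ^+ d.+1)^-1) ^+ n <= eps / 4 :> R.
    apply: (@le_trans _ _ (m.+1%:R * (eps / 4 / m.+1%:R))).
      apply: ler_pM => //; last by rewrite ler_nat.
      by rewrite exprn_ge0 // subr_ge0; case/andP: q01.
    by rewrite mulrCA divff ?mulr1 // pnatr_eq0.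
  by move=> ub2; exfalso; lra.
have Jk : (#|J| <= k)%N by rewrite (leq_trans cJ).
have [A AJ densA] := dense_fiber JW Jk dens.
have cAJ := subset_leq_card AJ.
have cWJ := cardsDS JW; have cJW := subset_leq_card JW.
have fA := sdlt_restrict AJ JW (leq_trans cAJ Jk) hJ.
have [s1 s2 s3] := shift _ _ _ _ _ _ _ _ hk h1 h2 cAJ cJ cJW.
rewrite -cWJ in s2 s3.
have [J' [A' [AJ' JW' cJ' const]]] := H V (W :\: J) (fun S => f (A :|: S))
  (k - #|A|)%N l s1 s2 s3 fA densA.
have dJ : [disjoint J & J'].
  by move: JW'; rewrite subsetD disjoint_sym => /andP[].
exists (J :|: J'), (A :|: A'); split.
- exact: setUSS.
- by rewrite subUset JW (subset_trans JW' (subsetDl _ _)).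
- by rewrite (leq_trans (leq_card_setU _ _)) // addnC leq_add.
- move=> S; rewrite -setDDl cardsU.
  have -> : A :&: A' = set0.
    by apply/disjoint_setI0/(disjointWl AJ)/(disjointWr AJ').
  by rewrite cards0 subn0 subnDA -setUA => /const.
Qed.

End Structure.

(** * Sums of weights that are constant on a slice *)

Lemma bin_sum_small (B n : nat) : exists K, forall m, (K <= m)%N ->
  (B.+1 * \sum_(0 <= j < n.+1) 'C(m, j) < 'C(m, n.+1))%N.
Proof.
elim: n => [|n [K IH]].
  by exists B.+2 => m hm; rewrite big_nat1 bin0 bin1 muln1.
exists (K + n.+1 + 2 * B.+1 * n.+2)%N => m hm.
rewrite big_nat_recr //= mulnDr.
have h1 := IH m ltac:(lia).
rewrite -(ltn_pmul2l (ltn0Sn n.+1)) mul_bin_left.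
apply: (@leq_trans (n.+2 * (2 * B.+1 * 'C(m, n.+1)))%N).
  by rewrite ltn_pmul2l // -mulnA mul2n -addnn ltn_add2r (leq_trans h1) // leq_pmull.
by rewrite mulnA leq_mul2r; apply/orP; right; lia.
Qed.

(** A nonzero integer leading coefficient has absolute value at least 1, and for large [m] its
    binomial exceeds the sum of all lower terms. *)
Lemma bounded_bin_sum_eq0 (B n : nat) : exists K, forall m (u : nat -> int),
  (K <= m)%N -> (forall j, `|u j| <= B%:Z) ->
  \sum_(0 <= j < n.+1) u j * ('C(m, j))%:Z = 0 ->
  forall j, (j <= n)%N -> u j = 0.
Proof.
elim: n => [|n [K IH]].
  by exists 0%N => m u _ _; rewrite big_nat1 bin0 mulr1 => h [].
have [K' hK'] := bin_sum_small B n.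
exists (K + K')%N => m u hm ub; rewrite big_nat_recr //= => h.
have un0 : u n.+1 = 0.
  apply/eqP; rewrite -normr_eq0; apply/negPn/negP => un.
  have un1 : 1 <= `|u n.+1| by lia.
  have hb : `|u n.+1| * ('C(m, n.+1))%:Z <=
      \sum_(0 <= j < n.+1) (B%:Z * ('C(m, j))%:Z).
    have -> : `|u n.+1| * ('C(m, n.+1))%:Z =
        `|\sum_(0 <= j < n.+1) u j * ('C(m, j))%:Z|.
      by move/eqP: h; rewrite addr_eq0 => /eqP->; rewrite normrN normrM.
    apply: le_trans (ler_norm_sum _ _ _) _; apply: ler_sum => j _.
    by rewrite normrM ler_wpM2r.
  have := hK' m ltac:(lia); rewrite -(ltr_nat int) natrM natr_sum.
  move: hb; rewrite -mulr_sumr !natz.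
  have -> : \sum_(0 <= i < n.+1) ('C(m, i))%:R = \sum_(0 <= i < n.+1) ('C(m, i))%:Z :> int.
    by apply: eq_bigr => i _; rewrite natz.
  have s0 : 0 <= \sum_(0 <= i < n.+1) ('C(m, i))%:Z :> int by apply: sumr_ge0.
  have c0 : 0 <= ('C(m, n.+1))%:Z by [].
  have := ler_wpM2r c0 un1; rewrite mul1r -[B.+1]addn1 PoszD mulrDl mul1r.
  move=> a b c; lra.
move=> j; rewrite leq_eqVlt => /predU1P[->//|]; rewrite ltnS.
apply: (IH m) => //; first by lia.
by move: h; rewrite un0 mul0r addr0.
Qed.

Section Weights.
Variable V : finType.
Implicit Types (W S T : {set V}) (w : {set V} -> int).

Definition wsum w S : int := \sum_(T : {set V} | T \subset S) w T.

Lemma wsumU1 w x S : x \notin S ->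
  wsum w (x |: S) = wsum w S + wsum (fun T => w (x |: T)) S.
Proof.
move=> xS; rewrite {1}/wsum (bigID (fun T : {set V} => x \in T)) /= addrC.
congr (_ + _).
  apply: eq_bigl => T; have [xT|xT] := boolP (x \in T).
    rewrite andbF; apply/esym/negbTE; apply: contra xS.
    by move=> /fintype.subsetP; apply.
  rewrite andbT; apply/idP/idP => [/fintype.subsetP h|h].
    apply/fintype.subsetP => v vT; have := h v vT.
    by rewrite !inE; case: eqP => // e; rewrite -e vT in xT.
  exact: subset_trans h (subsetU1 _ _).
rewrite (reindex_onto (fun T => x |: T) (fun T => T :\ x)) /=; last first.
  by move=> T /andP[_ xT]; rewrite setD1K.
apply: eq_bigl => T; rewrite setU11 andbT.
apply/andP/idP => [[h /eqP e]|h].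
  have xT : x \notin T by rewrite -e setD11.
  apply/fintype.subsetP => v vT; have := fintype.subsetP h v.
  rewrite !inE vT orbT => /(_ isT); case: eqP => // vx.
  by rewrite -vx vT in xT.
split; first exact: setUS.
by rewrite setU1K //; apply: contra xS => /(fintype.subsetP h).
Qed.

Lemma eq_wsum w w' S : (forall T, T \subset S -> w T = w' T) ->
  wsum w S = wsum w' S.
Proof. exact: eq_bigr. Qed.

Lemma wsum_uniform (r : nat) w (u : nat -> int) S :
  (forall T : {set V}, T \subset S -> w T = if (#|T| <= r)%N then u #|T| else 0) ->
  wsum w S = \sum_(0 <= j < r.+1) u j * ('C(#|S|, j))%:Z.
Proof.
move=> h; rewrite big_mkord.
rewrite /wsum (bigID (fun T : {set V} => (#|T| < r.+1)%N)) /= addrC big1 ?add0r.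
  rewrite (partition_big (fun T : {set V} => inord #|T| : 'I_r.+1) xpredT) //=.
  apply: eq_bigr => j _.
  rewrite (eq_bigr (fun=> u j)).
    rewrite sumr_const -mulr_natr natz; congr (_ * (_%:Z)).
    rewrite -cards_draws cardsE; apply: eq_card => T; rewrite !unfold_in.
    rewrite -val_eqE /= -andbA; congr (_ && _).
    apply/andP/eqP => [[Tr /eqP]|->]; first by rewrite inordK.
    by rewrite ltn_ord inordK.
  move=> T /andP[/andP[TS Tr] /eqP <-]; rewrite h // inordK // -ltnS Tr //.
by move=> T /andP[TS]; rewrite ltnS => /negbTE Tr; rewrite h // Tr.
Qed.

Definition initial S (j : nat) : {set V} := [set v in take j (enum S)].

Lemma initial_subset S j : initial S j \subset S.
Proof. by apply/fintype.subsetP => v; rewrite inE => /mem_take; rewrite mem_enum. Qed.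

Lemma card_initial S j : (j <= #|S|)%N -> #|initial S j| = j.
Proof.
move=> jS; rewrite cardsE (card_uniqP _) ?take_uniq ?enum_uniq //.
by rewrite size_take -cardE; case: ltngtP jS.
Qed.

Lemma slice_nonempty W k : (k <= #|W|)%N -> exists S, S \in slice W k.
Proof.
move=> kW; exists (initial W k).
by rewrite inE initial_subset card_initial //=.
Qed.
End Weights.

(* Differentiate in an exchange x <-> y: the weights w (x |: T) - w (y |: T)
   have degree one less, hence by induction depend only on #|T|, and a bounded
   combination of binomial coefficients vanishes only trivially. *)
Lemma constant_wsum (r C : nat) : exists K, forall (V : finType) (W : {set V})
    (w : {set V} -> int) (k : nat) (c : int), (K <= k)%N -> (k + r <= #|W|)%N ->
  (forall T, `|w T| <= C%:Z) -> (forall T : {set V}, (r < #|T|)%N -> w T = 0) ->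
  {in slice W k, forall S, wsum w S = c} ->
  forall T T' : {set V}, T \subset W -> T' \subset W -> #|T| = #|T'| -> w T = w T'.
Proof.
elim: r C => [|r IH] C.
  exists 0%N => V W w k c _ _ _ w0 _ T T' _ _ e.
  have [T0|T0] := posnP #|T|; last by rewrite !w0 -?e.
  by move: (T0); rewrite e => /cards0_eq->; rewrite (cards0_eq T0).
have [K1 h1] := IH (2 * C)%N.
have [K2 h2] := bounded_bin_sum_eq0 (2 * C) r.
exists (K1 + K2 + r).+1 => V W w k c hk kW wC w0 const T T' TW TW' cTT'.
apply: (@exchange_cst _ _ w W #|T|) => // {T T' TW TW' cTT'} T x y TW xW yW xy xT yT _.
(* Setting [v] to 0 on sets meeting [x] or [y] gives the bound and the vanishing above size [r] for
   every [T], as the induction hypothesis demands. *)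
pose v (T : {set V}) := if (x \in T) || (y \in T) then 0 else w (x |: T) - w (y |: T).
pose W' := W :\ x :\ y.
have vE : v T = w (x |: T) - w (y |: T).
  by rewrite /v (negbTE xT) (negbTE yT).
suff : v T = 0 by rewrite vE => /subr0_eq.
have cW' : #|W| = #|W'|.+2.
  by rewrite (cardsD1 x W) xW (cardsD1 y (W :\ x)) !inE yW eq_sym xy.
have [k1 k2 rk kW'] : [/\ K1 <= k.-1, K2 <= k.-1, r <= k.-1
    & k.-1 + r <= #|W'|]%N by clear -hk kW cW'; split; lia.
have vC U : `|v U| <= (2 * C)%N%:Z.
  rewrite /v; case: ifP => _; first by rewrite normr0.
  by have := wC (x |: U); have := wC (y |: U); lia.
have v0 (U : {set V}) : (r < #|U|)%N -> v U = 0.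
  move=> rU; rewrite /v; case: ifPn => //; rewrite negb_or => /andP[xU yU].
  by rewrite !w0 ?cardsU1 ?xU ?yU.
have vS : {in slice W' k.-1, forall S, wsum v S = 0}.
  move=> S; rewrite inE !subsetD1 => /andP[/andP[/andP[SW xS] yS] /eqP cS].
  have E z : z \in W -> z \notin S -> wsum w (z |: S) = c.
    move=> zW zS; apply: const; rewrite inE subUset sub1set zW SW cardsU1 zS cS.
    by rewrite add1n prednK ?eqxx // (leq_ltn_trans (leq0n _) hk).
  have := E x xW xS; have := E y yW yS; rewrite !wsumU1 // => <- /addrI e.
  rewrite (@eq_wsum _ _ (fun T => w (x |: T) - w (y |: T))); last first.
    move=> U US; rewrite /v.
    by rewrite !(contraNF (fintype.subsetP US _)).
  by rewrite /wsum sumrB; apply/eqP; rewrite subr_eq0; apply/eqP.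
have vconst := h1 V W' v k.-1 0 k1 kW' vC v0 vS.
have [S0 S0k] := @slice_nonempty _ W' k.-1 (leq_trans (leq_addr _ _) kW').
move: (S0k); rewrite inE => /andP[S0W /eqP cS0].
have TW' : T \subset W' by rewrite !subsetD1 TW xT yT.
have [Tr|Tr] := leqP #|T| r; last exact: v0.
have iS j : (j <= r)%N -> #|initial S0 j| = j.
  by move=> jr; rewrite card_initial // cS0 (leq_trans jr).
have iW j : initial S0 j \subset W' by apply: subset_trans (initial_subset _ _) S0W.
have := h2 k.-1 (fun j => v (initial S0 j)) k2 (fun j => vC _) _ #|T| Tr.
rewrite (vconst _ T) ?iS //; apply.
rewrite -[RHS](vS S0) // (@wsum_uniform _ r v (fun j => v (initial S0 j))) ?cS0 //.
move=> U US; case: leqP => Ur; last exact: v0.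
by apply: vconst; rewrite ?iS // (subset_trans US).
Qed.

(* Coordinates of C(k - d - s, r - d) in the basis C(k - i, r - i). *)
Fixpoint bin_coord (s d i : nat) : int :=
  if s is t.+1 then bin_coord t d i - bin_coord t d.+1 i else (i == d)%:Z.

(** Pascal's rule, by induction on [s]. Raising [d] past [r] leaves the basis, and the value 0 there
    keeps the recursion valid at [d = r]. *)
Lemma bin_coordE (r k s d : nat) : (d + s <= k)%N ->
  \sum_(0 <= i < r.+1) bin_coord s d i * ('C(k - i, r - i))%:Z =
  if (d <= r)%N then ('C(k - d - s, r - d))%:Z else 0.
Proof.
elim: s d => [|s IH] d hd /=.
  rewrite subn0 big_mkord; case: ifPn => dr.
    rewrite (bigD1 (inord d)) //= inordK // eqxx mul1r big1 ?addr0 // => i.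
    rewrite -val_eqE /= inordK // => /negbTE->; exact: mul0r.
  apply: big1 => i _; have -> : (i == d :> nat) = false.
    by apply/negbTE; apply: contraNneq dr => <-; rewrite -ltnS.
  exact: mul0r.
under eq_bigr do rewrite mulrBl.
rewrite sumrB !IH; try lia.
case: (ltngtP d r) => [dr|dr|->]; rewrite ?subr0 //.
  have -> : (r - d = (r - d.+1).+1)%N by lia.
  have -> : (k - d - s = (k - d - s.+1).+1)%N by lia.
  have -> : (k - d.+1 - s = k - d - s.+1)%N by lia.
  by rewrite binS PoszD addrK.
by rewrite subnn !bin0.
Qed.

(** With [bin_coord_diag] this is the unitriangularity that lets the coordinate 0 inherit a value in
    {0, 1}. *)
Lemma bin_coord_low s d i : (i < d)%N -> bin_coord s d i = 0.
Proof.
elim: s d => [|s IH] d id /=; first by rewrite (ltn_eqF id).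
by rewrite !IH ?subrr // ltnW.
Qed.

Lemma bin_coord_diag s d : bin_coord s d d = 1.
Proof.
by elim: s d => [|s IH] d /=; rewrite ?eqxx // IH bin_coord_low ?subr0.
Qed.

Lemma bin_coord_bound s d i : `|bin_coord s d i| <= (2 ^ s)%:Z.
Proof.
elim: s d => [|s IH] d /=; first by case: (i == d).
rewrite expnS; apply: le_trans (ler_normB _ _) _.
by have := IH d; have := IH d.+1; lia.
Qed.

(** Double counting: each [k]-subset [S] of [W] survives the deletion of exactly [#|W| - k]
    vertices, so the density on [W] is the average of the densities after one deletion. *)
Lemma remove_vertex (R : archiRealFieldType) (V : finType) (W : {set V})
    (k : nat) (P : pred {set V}) (eps : R) : (k < #|W|)%N ->
  eps * ('C(#|W|, k))%:R <= #|[set S in slice W k | P S]|%:R ->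
  exists2 v, v \in W & eps * ('C(#|W|.-1, k))%:R
    <= #|[set S in slice (W :\ v) k | P S]|%:R.
Proof.
move=> kW dens.
have [/existsP[v /andP[vW hv]]|] := boolP [exists v, (v \in W) &&
  (eps * ('C(#|W|.-1, k))%:R <= #|[set S in slice (W :\ v) k | P S]|%:R)].
  by exists v.
rewrite negb_exists => /forallP no; exfalso.
have W0 : (0 < #|W|)%N by apply: leq_ltn_trans kW.
have: \sum_(v in W) #|[set S in slice (W :\ v) k | P S]|%:R <
    \sum_(v in W) eps * ('C(#|W|.-1, k))%:R.
  apply: ltr_sum => [|v vW]; last by have := no v; rewrite vW /= -ltNge.
  by have /card_gt0P[v vW] := W0; apply/hasP; exists v; rewrite ?mem_index_enum.
rewrite ltNge => /negP; apply.
rewrite sumr_const -natr_sum.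
have -> : (\sum_(v in W) #|[set S in slice (W :\ v) k | P S]|
    = (#|W| - k) * #|[set S in slice W k | P S]|)%N.
  transitivity (\sum_(v in W) \sum_(S in [set S in slice W k | P S] | v \notin S) 1)%N.
    apply: eq_bigr => v vW; rewrite -sum1_card; apply: eq_bigl => S.
    rewrite !inE subsetD1 -!andbA; congr (_ && _); rewrite andbC -!andbA.
    by congr (_ && _).
  rewrite (exchange_big_dep (fun S => S \in [set S in slice W k | P S])) //=;
    last by move=> v S _ /andP[].
  rewrite mulnC -sum_nat_const; apply: eq_bigr => S.
  rewrite !inE => /andP[/andP[SW /eqP cS] PS].
  rewrite sum1_card -cS -cardsDS //; apply: eq_card => v.
  by rewrite [LHS]unfold_in /= SW eqxx PS inE andbC.
rewrite natrM -[leLHS]mulr_natl mulrCA.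
have -> : #|W|%:R * ('C(#|W|.-1, k))%:R = (#|W| - k)%:R * ('C(#|W|, k))%:R :> R.
  by rewrite -!natrM mul_bin_down.
by rewrite mulrCA ler_wpM2l.
Qed.

Lemma dense_subset (R : archiRealFieldType) (V : finType) (W : {set V})
    (k m : nat) (P : pred {set V}) (eps : R) : (k <= m)%N -> (m <= #|W|)%N ->
  eps * ('C(#|W|, k))%:R <= #|[set S in slice W k | P S]|%:R ->
  exists2 U : {set V}, #|U| = m & eps * ('C(m, k))%:R
    <= #|[set S in slice U k | P S]|%:R.
Proof.
move=> km; move: {2}#|W| (erefl #|W|) => N; elim: N W => [|N IH] W cW mW dens.
  have m0 : m = 0%N by move: mW; rewrite cW leqn0 => /eqP.
  by exists W; rewrite cW m0 // -m0 -{1}cW in dens *; rewrite -{1}m0 -cW.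
have [e|lt_mW] := eqVneq m #|W|; first by exists W; rewrite // e.
have {}lt_mW : (m < #|W|)%N by rewrite ltn_neqAle lt_mW mW.
have [v vW densv] := remove_vertex (leq_ltn_trans km lt_mW) dens.
have cWv : #|W :\ v| = N by move: cW; rewrite (cardsD1 v) vW => -[].
apply: (IH (W :\ v)) => //; first by rewrite cWv -ltnS -cW.
by move: densv; rewrite cW cWv.
Qed.

(** * Edge counts *)

Section Hypergraph.
Variables (V : finType) (r : nat) (H : {set {set V}}).
Hypothesis H_unif : uniform_hypergraph r H.
Implicit Types (A S T e : {set V}).

Lemma card_edge e : e \in H -> #|e| = r.
Proof. by move=> eH; apply/eqP; move/forall_inP: H_unif; apply. Qed.

Lemma dlt_subset T : dlt #|T|.+1 (fun S => (T \subset S)%:Z).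
Proof.
move cT: #|T| => n; elim: n T cT => [|n IH] T cT.
  move/cards0_eq: cT => ->; apply: (@eq_dlt _ 1 (fun=> 1)); last exact: dlt_cst.
  by move=> S; rewrite sub0set.
move=> i; have [iT|iT] := boolP (i \in T).
  apply: (@eq_dlt _ _ (fun S => (T :\ i \subset S)%:Z)); last first.
    by apply: IH; move: cT; rewrite (cardsD1 i) iT => -[].
  move=> S; rewrite /deriv subDset -[T \subset S :\ i]negbK.
  by rewrite [in X in _ - X](subsetD1 T S i) iT andbF subr0.
apply: dlt0 => S; rewrite /deriv subsetD1 iT andbT.
suff -> : (T \subset i |: S) = (T \subset S) by rewrite subrr.
apply/idP/idP => [h|h]; last exact: subset_trans h (subsetU1 _ _).
apply/fintype.subsetP => v vT; have := fintype.subsetP h v vT.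
by rewrite !inE; case: eqP => // e; rewrite -e vT in iT.
Qed.

Lemma dlt_sum (n : nat) (s : seq {set V}) (F : {set V} -> {set V} -> int) :
  {in s, forall e, dlt n (F e)} -> dlt n (fun S => \sum_(e <- s) F e S).
Proof.
elim: s => [|e s IH] h; first by apply: dlt0 => S; rewrite big_nil.
apply: (@eq_dlt _ _ (fun S => F e S - (0 - \sum_(e <- s) F e S))).
  by move=> S; rewrite big_cons sub0r opprK.
apply: dltB; first by apply: h; rewrite mem_head.
apply: dltB; first exact: dlt0.
by apply: IH => a aS; apply: h; rewrite inE aS orbT.
Qed.

Lemma card_induced_edges S :
  #|induced_edges H S|%:Z = \sum_(e in H) (e \subset S)%:Z.
Proof.
rewrite -sum1_card -natz natr_sum (eq_bigl (fun e => (e \in H) && (e \subset S))).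
  by rewrite big_mkcondr; apply: eq_bigr => e _; case: (e \subset S).
by move=> e; rewrite inE.
Qed.

Lemma dlt_induced_edges : dlt r.+1 (fun S => #|induced_edges H S|%:Z).
Proof.
apply: (@eq_dlt _ _ (fun S => \sum_(e <- enum H) (e \subset S)%:Z)).
  by move=> S; rewrite card_induced_edges big_enum.
apply: dlt_sum => e; rewrite mem_enum => eH.
by rewrite -{1}(card_edge eH); apply: dlt_subset.
Qed.

Definition trace_count A T := #|[set e in H | e :\: A == T]|%:Z.

Lemma induced_edges_trace A S :
  #|induced_edges H (A :|: S)|%:Z = wsum (trace_count A) S.
Proof.
rewrite /wsum /trace_count -sum1_card -natz natr_sum.
rewrite (partition_big (fun e => e :\: A) (fun T => T \subset S)) /=; last first.
  by move=> e; rewrite inE => /andP[_]; rewrite subDset.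
apply: eq_bigr => T TS; rewrite -sum1_card -[RHS]natz natr_sum.
apply: eq_bigl => e; rewrite !inE; case: eqP => [eT|]; last by rewrite !andbF.
by rewrite !andbT -subDset eT TS andbT.
Qed.

Lemma trace_count_high A T : (r < #|T|)%N -> trace_count A T = 0.
Proof.
move=> rT; rewrite /trace_count (_ : [set _ in _ | _] = set0) ?cards0 //.
apply/setP => e; rewrite !inE; apply/negP => /andP[eH /eqP eT].
move: rT; rewrite -eT -(card_edge eH) ltnNge => /negP; apply.
exact/subset_leq_card/subsetDl.
Qed.

(** An edge with trace [T] outside [A] is determined by its intersection with [A]. *)
Lemma trace_count_bound A T : `|trace_count A T| <= (2 ^ #|A|)%:Z.
Proof.
rewrite /trace_count ger0_norm // -card_powerset lez_nat.
rewrite -[X in (X <= _)%N](card_in_imset (f := fun e => e :&: A)).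
    by apply/subset_leq_card/fintype.subsetP => _ /imsetP[e _ ->]; rewrite inE subsetIr.
move=> e e'; rewrite !inE => /andP[_ /eqP h] /andP[_ /eqP h'] ee'.
by rewrite -(setID e A) ee' h -h' setID.
Qed.

Lemma trace_count_top A T : #|T| = r ->
  trace_count A T = 0 \/ trace_count A T = 1.
Proof.
move=> cT; have : (trace_count A T <= 1).
  rewrite lez_nat -(cards1 T); apply/subset_leq_card/fintype.subsetP => e.
  rewrite !inE => /andP[eH /eqP eT]; rewrite -eT; apply/eqP/esym/eqP.
  by rewrite eqEcard subsetDl eT cT (card_edge eH) /=.
by rewrite /trace_count; case: #|_| => [|[|]]; [left|right|].
Qed.
End Hypergraph.

Lemma edge_count_form (R : archiRealFieldType) (r : nat) (eps : R) : 0 < eps ->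
  exists C K : nat, forall (V : finType) (H : {set {set V}}) (k : nat) (l : int),
    uniform_hypergraph r H -> (K <= k)%N -> (2 * k <= #|V|)%N ->
    eps * ('C(#|V|, k))%:R <= (num_inducing H k l)%:R ->
    exists a : nat -> int,
      [/\ a 0%N = 0 \/ a 0%N = 1, forall d, `|a d| <= C%:Z
        & l = \sum_(0 <= d < r.+1) a d * ('C(k - d, r - d))%:Z].
Proof.
move=> eps0.
have [c [k0 struct]] := slice_structure r 0 eps0.
have [K1 cw] := constant_wsum r (2 ^ (c + r)).
(* A sum of [r.+1] products: one factor [2 ^ (c + r)] bounds a trace weight, the other a coordinate
   from [bin_coord]. *)
exists (r.+1 * (2 ^ (c + r) * 2 ^ (c + r)))%N, (k0 + K1 + 2 * (c + r) + r)%N.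
move=> V H k l unifH hk kV dens.
have densT : eps * ('C(#|[set: V]|, k))%:R <=
    #|[set S in slice [set: V] k | #|induced_edges H S|%:Z == l]|%:R.
  rewrite cardsT; apply: le_trans dens _; rewrite ler_nat.
  apply/subset_leq_card/fintype.subsetP => S; rewrite !inE => /andP[-> ->].
  by rewrite subsetT.
have VT : (2 * k <= #|[set: V]|)%N by rewrite cardsT.
have [W cW densW] := dense_subset (leq_pmull k (isT : 0 < 2)%N) VT densT.
rewrite -cW in densW.
have sz : [/\ k0 <= k, #|W| <= 2 * k + 0 & 2 * k <= #|W| + 0]%N.
  by clear -hk cW; split; lia.
case: sz => s1 s2 s3.
have fdeg : sdlt r.+1 W k (fun S => #|induced_edges H S|%:Z).
  move=> p S sp /and5P[up _ _ pS _].
  exact: sdiff_dlt (dlt_induced_edges unifH) sp up pS.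
have [J [A [AJ JW cJ const]]] := struct V W _ k l s1 s2 s3 fdeg densW.
have cWJ := cardsDS JW; have cAJ := subset_leq_card AJ.
have cJW := subset_leq_card JW.
have rWJ : (r <= #|W :\: J|)%N by clear -cWJ cW cJ hk; lia.
(* Forcing [r] more vertices into [S] ensures [r <= #|B|], so that ['C(k - #|B|, r - d)] has the
   form ['C(k - d - s, r - d)] with [s] a natural number, for every [d <= r]. *)
pose A1 := initial (W :\: J) r; have cA1 : #|A1| = r by apply: card_initial.
have A1WJ : A1 \subset W :\: J by apply: initial_subset.
have dJA1 : [disjoint J & A1].
  by move: A1WJ; rewrite subsetD disjoint_sym => /andP[].
have dAA1 : [disjoint A & A1] by apply: disjointWl AJ dJA1.
pose B := A :|: A1; pose U := W :\: J :\: A1.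
have cB : #|B| = (#|A| + r)%N.
  by rewrite cardsU (disjoint_setI0 dAA1) cards0 subn0 cA1.
have cU : #|U| = (2 * k - #|J| - r)%N by rewrite cardsDS // cWJ cA1 cW.
have constB : {in slice U (k - #|B|), forall S, wsum (trace_count H B) S = l}.
  move=> S; rewrite inE subsetD => /andP[/andP[SWJ dSA1] /eqP cS].
  rewrite -induced_edges_trace -setUA; apply: const.
  rewrite inE subUset A1WJ SWJ cardsU [A1 :&: S]setIC (disjoint_setI0 dSA1).
  by rewrite cards0 subn0 cA1 cS cB; apply/eqP; clear -hk cJ cAJ; lia.
have [t1 t2 t3 t4] : [/\ K1 <= k - #|B|, k - #|B| + r <= #|U|, #|B| <= c + r
    & r <= k - #|B|]%N.
  by clear -hk cJ cAJ cB cU; split; lia.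
have wb T : `|trace_count H B T| <= (2 ^ (c + r))%N%:Z.
  apply: le_trans (trace_count_bound _ _ _) _.
  by rewrite lez_nat leq_pexp2l.
have wconst := cw V U _ _ l t1 t2 wb
  (@trace_count_high V r H unifH B) constB.
have [S0 S0k] := slice_nonempty (leq_trans (leq_addr r _) t2).
have := constB S0 S0k; move: S0k; rewrite inE => /andP[S0U /eqP cS0].
pose u j := trace_count H B (initial S0 j).
have iS j : (j <= r)%N -> #|initial S0 j| = j.
  by move=> jr; rewrite card_initial // cS0 (leq_trans jr).
rewrite (@wsum_uniform _ r _ u) ?cS0; last first.
  move=> T TS; case: leqP => Tr; last exact: (trace_count_high unifH).
  apply: wconst; rewrite ?iS // ?(subset_trans TS) //.
  exact: subset_trans (initial_subset _ _) S0U.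
move=> lE; pose s := #|B|.
have rs : (r <= s)%N by rewrite /s cB leq_addl.
have sk : (s <= k)%N by clear -t4 t3 hk; rewrite /s; lia.
(* The weight of sets of size [r - d] multiplies ['C(k - #|B|, r - d)], which is expanded with shift
   [#|B| - d]. In coordinate 0 only [d = 0] contributes, leaving [u r]. *)
exists (fun i => \sum_(0 <= d < r.+1) u (r - d)%N * bin_coord (s - d) d i); split.
- rewrite big_nat_recl // big_nat big1 ?addr0 => [|d _].
    rewrite subn0 bin_coord_diag mulr1.
    by apply: (trace_count_top unifH); apply: iS.
  by rewrite bin_coord_low ?mulr0.
- move=> i; apply: le_trans (ler_norm_sum _ _ _) _.
  apply: (@le_trans _ _ (\sum_(0 <= d < r.+1) (2 ^ (c + r) * 2 ^ (c + r))%N%:Z)).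
    apply: ler_sum => d _; rewrite normrM PoszM.
    apply: ler_pM; rewrite ?normr_ge0 //; first exact: wb.
    apply: le_trans (bin_coord_bound _ _ _) _; rewrite lez_nat leq_pexp2l //.
    by rewrite (leq_trans (leq_subr _ _)).
  by rewrite big_const_nat subn0 iter_addr_0 -mulr_natl natz.
- under eq_bigr do rewrite mulr_suml.
  rewrite exchange_big /= -lE.
  rewrite [LHS]big_nat_rev /= add0n big_nat [RHS]big_nat.
  apply: eq_bigr => d /andP[_ dr].
  under eq_bigr do rewrite -mulrA.
  rewrite -mulr_sumr subSS bin_coordE; last first.
    by rewrite subnKC // (leq_trans _ rs).
  rewrite -ltnS dr; congr (_ * ('C(_, _))%:Z).
  by rewrite -subnDA subnKC // (leq_trans _ rs).
Qed.

(* From the limit to finite hypergraphs *)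
From mathcomp Require Import all_classical all_reals all_analysis.
Import numFieldNormedType.Exports.

Lemma inducibility_witness (R : realType) (r k : nat) (l : int) (eps : R) :
  0 < eps -> eps < inducibility R r k l ->
  exists n (H : {set {set 'I_n}}), [/\ uniform_hypergraph r H, (2 * k <= n)%N
    & eps * ('C(n, k))%:R <= (num_inducing H k l)%:R].
Proof.
move=> eps0; rewrite /inducibility; set u := (fun n : nat => _).
move=> hl.
(* In the divergent case [lim] has the default value 0, contradicting [0 < eps < lim]. *)
have [cv|ncv] := pselect (cvg (u @ \oo)%classic); last first.
  by move: hl; rewrite (dvgP ncv) => /(lt_trans eps0); rewrite ltxx.
have [N _ hN] := cvgr_gt _ cv _ hl.
pose n := maxn N (2 * k).
have kn : (2 * k <= n)%N by apply: leq_maxr.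
have := hN n (leq_maxl _ _); rewrite /= /u.
have C0 : 0 < ('C(n, k))%:R :> R by rewrite ltr0n bin_gt0 (leq_trans _ kn) // leq_pmull.
rewrite ltr_pdivlMr // => /ltW hn.
have ex : (0 < #|[pred H : {set {set 'I_n}} | uniform_hypergraph r H]|)%N.
  apply/card_gt0P; exists finset.set0; rewrite inE /uniform_hypergraph.
  by apply/forallP => e; rewrite inE.
have [H unifH maxH] := eq_bigmax_cond (fun H => num_inducing H k l) ex.
exists n, H; split=> //.
by rewrite -maxH; move: hn; rewrite /max_inducing.
Qed.

Lemma num_inducing_bound (V : finType) (H : {set {set V}}) (k : nat) (l : int) :
  (0 < num_inducing H k l)%N -> `|l| <= (2 ^ k)%N%:Z.
Proof.
case/card_gt0P => S; rewrite inE => /andP[/eqP <- /eqP <-].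
rewrite ger0_norm // lez_nat -card_powerset.
apply/subset_leq_card/fintype.subsetP => e.
by rewrite !inE => /andP[].
Qed.

Theorem theorem1p6 (R : realType) (r : nat) (hr : (2 <= r)%N)
    (eps : R) (heps : 0 < eps) :
  exists C : int, forall (k : nat) (l : int), (r <= k)%N ->
    eps < inducibility R r k l ->
    exists a : nat -> int,
      [/\ a 0%N = 0 \/ a 0%N = 1,
          forall d : nat, (1 <= d <= r)%N -> - C <= a d <= C
        & l = \sum_(0 <= d < r.+1) a d * ('C(k - d, r - d))%:Z].
Proof.
have [C [K form]] := edge_count_form r heps.
exists (C + 2 ^ K)%N%:Z => k l rk hl.
have [n [H [unifH kn dens]]] := inducibility_witness heps hl.
have bound (x : int) B : `|x| <= B%:Z -> (B <= C + 2 ^ K)%N ->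
    - (C + 2 ^ K)%N%:Z <= x <= (C + 2 ^ K)%N%:Z by lia.
have [Kk|kK] := leqP K k.
  have [||a [a0 ab al]] := form 'I_n H k l unifH Kk; rewrite ?card_ord //.
  exists a; split=> // d _; apply: (bound _ _ (ab d)).
  exact: leq_addr.
have lb : `|l| <= (2 ^ k)%N%:Z.
  apply: (@num_inducing_bound _ H); rewrite -(ltr0n R); apply: lt_le_trans dens.
  by rewrite mulr_gt0 // ltr0n bin_gt0 (leq_trans _ kn) // leq_pmull.
(* For the bounded range [k < K], the basis element at [d = r] is 1, so [l] itself, at most [2 ^ K]
   in absolute value, serves as that coefficient. *)
exists (fun d => if d == r then l else 0); split.
- by left; rewrite ifN // eq_sym -lt0n (leq_trans _ hr).
- move=> d _; case: eqP => _; last by apply: (bound _ 0%N); rewrite ?normr0.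
  by apply: bound lb _; rewrite (leq_trans _ (leq_addl _ _)) // leq_pexp2l // ltnW.
- rewrite big_nat_recr //= eqxx subnn bin0 mulr1 big_nat big1 ?add0r // => d.
  by move=> /andP[_ dr]; rewrite ltn_eqF ?mul0r.
Qed.
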